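(* Let $p\in\mathbb{N}$. For each $n\in\mathbb{N}$ let $n_0,n_1,\dots,n_p$ be positive integers (depending on $n$) such that the limits $d_j=\lim_{n\to\infty}n_j/n$ exist and are finite for $0\le j\le p$. For $1\le j\le p$ let $X_j(n)$ be a random $n_{j-1}\times n_j$ matrix, such that all entries of $X_1(n),\dots,X_p(n)$ are independent complex $(0,1/n)$-Gaussian variables, and let $$B(n)=X_1(n)X_2(n)\cdots X_p(n).$$ Then for every $k\in\mathbb{N}$, $k\ge1$, $$\lim_{n\to\infty}\tau_0(n)\big((B(n)B^*(n))^k\big)=P_k(d_0,d_1,\dots,d_p),$$ where $$P_k(d_0,d_1,\dots,d_p)=\sum_{j_0+\dots+j_p=pk+1}\frac1k\binom{k}{j_0}\binom{k}{j_1}\cdots\binom{k}{j_p}\,d_0^{\,j_0-1}d_1^{\,j_1}\cdots d_p^{\,j_p},$$ the sum being over natural numbers $j_0,\dots,j_p$.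
   Context: $\tau_0(n)$ is the expectation of the normalized trace over the $n_0$ basis vectors: for a random $n_0\times n_0$ matrix $A$, $\tau_0(n)(A)=\mathbb{E}\big(\frac1{n_0}\mathrm{Tr}(A)\big)$, with $\mathrm{Tr}$ the usual trace. $B^*(n)$ is the conjugate transpose of $B(n)$. A complex $(0,\sigma^2)$-Gaussian variable is a centered complex Gaussian with independent real and imaginary parts, each of variance $\sigma^2/2$. In the definition of $P_k$, all $j_i\ge1$ in every non-zero term (since each $j_i\le k$ and they sum to $pk+1$); the convention $0^0=1$ is used when some $d_i=0$. The polynomials $P_k$ are called multivariate Fuss–Narayana polynomials. *)

(* Defs.v *)
From HB Require Import structures.
From mathcomp Require Import all_boot all_order all_algebra.
From mathcomp Require Import all_classical all_reals all_analysis.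
From mathcomp Require Import complex.

Set Implicit Arguments.
Unset Strict Implicit.
Unset Printing Implicit Defensive.

Import Order.TTheory GRing.Theory Num.Theory.
Import numFieldNormedType.Exports.

Local Open Scope classical_set_scope.
Local Open Scope ring_scope.
Local Open Scope complex_scope.

(* Measurable sets of the complex plane are read off the pair (Re, Im) in the
   product sigma-algebra of R * R, as R[i] carries no measurableType. *)
Definition re_im (R : realType) (z : R[i]) : R * R :=
  (complex.Re z, complex.Im z).

Definition mutually_independent (d d' : measure_display) (R : realType)
    (T : measurableType d) (S : measurableType d') (P : probability T R)
    (I : finType) (Y : I -> T -> S) : Prop :=
  (forall i : I, measurable_fun setT (Y i)) /\
  forall (J : {set I}) (A : I -> set S),
    (forall i, measurable (A i)) ->
    P (\bigcap_(i in [set` J]) (Y i @^-1` A i)) =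
    (\prod_(i in J) P (Y i @^-1` A i))%E.

(* The second argument of normal_prob is a standard deviation. *)
Definition is_gaussian (d : measure_display) (R : realType)
    (T : measurableType d) (P : probability T R) (m v : R) (Y : T -> R) : Prop :=
  measurable_fun setT Y /\
  forall A : set R, measurable A -> P (Y @^-1` A) = normal_prob m (Num.sqrt v) A.

Definition is_complex_gaussian (d : measure_display) (R : realType)
    (T : measurableType d) (P : probability T R) (v : R) (Z : T -> R[i]) : Prop :=
  [/\ is_gaussian P 0 (v / 2) (fun w => complex.Re (Z w)),
      is_gaussian P 0 (v / 2) (fun w => complex.Im (Z w)) &
      mutually_independent P
        (fun (b : bool) w => if b then complex.Re (Z w) else complex.Im (Z w))].

Definition cintegrable (d : measure_display) (R : realType)
    (T : measurableType d) (P : probability T R) (Z : T -> R[i]) : Prop :=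
  P.-integrable setT (fun w => (complex.Re (Z w))%:E) /\
  P.-integrable setT (fun w => (complex.Im (Z w))%:E).

(* Meaningful only when Z is cintegrable, since fine sends +oo and -oo to 0. *)
Definition cexpectation (d : measure_display) (R : realType)
    (T : measurableType d) (P : probability T R) (Z : T -> R[i]) : R[i] :=
  fine ('E_P[fun w => complex.Re (Z w)]) +i*
  fine ('E_P[fun w => complex.Im (Z w)]).

Definition normalized_trace (R : realType) (m : nat) (A : 'M[R[i]]_m) : R[i] :=
  m%:R^-1 * \tr A.

Definition expected_trace (d : measure_display) (R : realType)
    (T : measurableType d) (P : probability T R) (m : nat)
    (A : T -> 'M[R[i]]_m) : R[i] :=
  cexpectation P (fun w => normalized_trace (A w)).

(* chain_mulmx X p = X 0 *m X 1 *m ... *m X p.-1, so X j stands for the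
   factor written X_(j+1) when the factors are numbered from 1. *)
Fixpoint chain_mulmx (K : pzRingType) (N : nat -> nat)
    (X : forall j : nat, 'M[K]_(N j, N j.+1)) (p : nat) : 'M[K]_(N 0%N, N p) :=
  if p is q.+1 then chain_mulmx X q *m X q else 1%:M.

Definition entry_index (N : nat -> nat) (p : nat) : finType :=
  {j : 'I_p & ('I_(N j) * 'I_(N j.+1))%type}.

Definition entry (K : Type) (N : nat -> nat) (p : nat)
    (X : forall j : nat, 'M[K]_(N j, N j.+1)) (e : entry_index N p) : K :=
  X (tag e) (tagged e).1 (tagged e).2.

(* Every index of the sum is at most pk+1, hence the bound (p * k).+2.
   A term with some j i = 0 has a factor 'C(k, j l) with j l > k, hence is
   zero, so the truncation in (j ord0).-1 is harmless. *)
Definition fuss_narayana (R : realType) (p k : nat) (x : 'I_p.+1 -> R) : R :=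
  \sum_(j : {ffun 'I_p.+1 -> 'I_(p * k).+2} |
        (\sum_i j i)%N == (p * k).+1)
    k%:R^-1 * (\prod_i ('C(k, j i))%:R) *
    (x ord0 ^+ (j ord0).-1 *
     \prod_(i < p) x (lift ord0 i) ^+ j (lift ord0 i)).

(* Main.v *)
(** For k >= 1 and r < k let Lam_S(s), with S a set of r indices avoiding 0, be
    the determinant whose row 0 is constant 1 and whose row i <> 0 is e_(s i) if
    i is in S and e_i otherwise.  It is a linear functional on the group algebra
    of S_k on which multiplication by the sum of the x^(#cycles of s) s acts as
    the scalar prod_(i < k) (x + i - r); after averaging over conjugates it is
    the normalized character of the hook (k - r, 1^r).  The alternating sum of
    the Lam_S vanishes at every s that is not a k-cycle and has total mass k!,
    so that k! Tr(A^k) is the alternating sum over S of the numbers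
    sum_s Lam_S(s) sum_i prod_a A(i_a, i_(s a)).

    For A = B B^*, the Wick formula replaces each Gaussian factor X_j by such a
    multiplication, with x = n_(j-1); the last index contributes x = n_p.  Hence
      E Tr((B B^* )^k) =
        n^(-pk) / k! sum_(r < k) (-1)^r C(k-1, r)
                     prod_(j <= p) prod_(i < k) (n_j + i - r).
    Expanding in powers of the n_j, the sum over r is a (k-1)-st finite
    difference of polynomials in r; it kills the monomials of total degree above
    pk + 1 and gives the Fuss-Narayana coefficient in degree pk + 1, while
    monomials of smaller degree disappear in the limit.  The factor i = r makes
    every term divisible by n_0, which is what is needed when d_0 = 0. *)
From HB Require Import structures.
Require Import Defs.
From mathcomp Require Import all_boot all_order all_algebra all_fingroup.
From mathcomp Require Import ring lra zify.

Set Implicit Arguments.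
Unset Strict Implicit.
Unset Printing Implicit Defensive.

Import Order.TTheory GRing.Theory Num.Theory.

Local Open Scope ring_scope.

(** * Eigenvalues of the class function [y ^+ (#|T| - #|porbits s|)] *)

(** The pairings of the Wick formula are not sorted by genus. Convolution with x^(#cycles) is
    diagonalized instead, and this gives an exact formula at finite n. By the Jucys-Murphy
    factorization, the sum of the x^(#cycles s) s is the product over m of the x + J_m, where J_m is
    the sum of the transpositions (l m) with l before m. It acts on the representation of a
    partition as the product of the x + c over its contents c. Hooks suffice since, by
    Murnaghan-Nakayama, only their characters are nonzero on k-cycles; the contents of (k - r, 1^r)
    run from -r to k - r - 1. Character theory itself is avoided. The hook representation is the
    r-th exterior power of the permutation representation modulo constants, and Lam_S is a diagonal
    coefficient of it in the basis of the e_i, i <> 0. The eigenvalue computation uses only two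
    facts: antisymmetry in the rows of S, and that the row of ones is the sum of all rows of a
    permutation matrix. *)

Lemma big_perm_onU1 (T : finType) (V : nmodType) (U : {set T}) (m : T)
    (G : {perm T} -> V) : m \notin U ->
  \sum_(s | perm_on (m |: U) s) G s =
  \sum_(l in m |: U) \sum_(s | perm_on U s) G (s * tperm l m)%g.
Proof.
move=> mU.
rewrite (partition_big (fun s : {perm T} => s m) (mem (m |: U))) /=; last first.
  by move=> s sU; rewrite perm_closed // setU11.
apply: eq_bigr => l lU.
rewrite (reindex_onto (fun s => s * tperm l m)%g (fun s => s * tperm l m)%g) /=;
  last by move=> s _; rewrite -mulgA tperm2 mulg1.
apply: eq_bigl => s; rewrite -mulgA tperm2 mulg1 eqxx andbT.
have tU : perm_on (m |: U) (tperm l m).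
  by apply: subset_trans (tperm_on _ _) _; rewrite subUset !sub1set lU setU11.
apply/andP/idP => [[stU /eqP]|sU].
  rewrite permM => sm.
  have sm' : s m = m by apply: (@perm_inj _ (tperm l m)); rewrite sm tpermR.
  have /subsetP sU : perm_on (m |: U) s.
    by rewrite -[s]mulg1 -(tperm2 l m) mulgA; apply: perm_onM stU tU.
  apply/subsetP => a sa; have := sU a sa.
  by case/setU1P => // am; rewrite inE am sm' eqxx in sa.
have sm : s m = m by apply: (out_perm sU mU).
split; last by rewrite permM sm tpermR.
by apply: perm_onM tU; apply: subset_trans sU (subsetUr _ _).
Qed.

(** Since [s] fixes m, the transposition merges the singleton orbit of m into the orbit of l. *)
Lemma card_porbits_mul_tperm (T : finType) (U : {set T}) (s : {perm T}) (l m : T) :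
  perm_on U s -> m \notin U -> l != m ->
  #|porbits s| = #|porbits (s * tperm l m)%g|.+1.
Proof.
move=> sU mU lm; have sm : s m = m by apply: (out_perm sU mU).
(* [porbits_mul_tperm] multiplies on the left, so it is applied to inverses, which have the same
   orbits. *)
have /= := porbits_mul_tperm s^-1%g l m.
have -> : (tperm l m * s^-1 = (s * tperm l m)^-1)%g by rewrite invMg tpermV.
rewrite lm !porbitsV /=.
have -> : l \notin porbit s^-1%g m.
  rewrite porbitV; apply/negP => /porbitP[i li]; move/eqP: lm; apply; rewrite li.
  by elim: i {li} => [|i IH]; rewrite ?expg0 ?perm1 // expgSr permM IH.
lia.
Qed.

Lemma card_porbits_le (T : finType) (s : {perm T}) : (#|porbits s| <= #|T|)%N.
Proof. exact: leq_trans (leq_imset_card _ _) (max_card _). Qed.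

(** The exponent is the least number of transpositions with product [s]. Fixed points do not
    contribute to it, so sums over permutations supported on U can be computed by induction on U.
    With y = 1 / x this is x^(#cycles), rescaled to be 1 at the identity. *)
Definition cycle_weight (K : comNzRingType) (T : finType) (y : K) (s : {perm T}) : K :=
  y ^+ (#|T| - #|porbits s|).

Lemma cycle_weight1 (K : comNzRingType) (T : finType) (y : K) :
  cycle_weight y (1%g : {perm T}) = 1.
Proof.
rewrite /cycle_weight (_ : #|porbits 1%g| = #|T|) ?subnn //.
rewrite card_in_imset ?cardsT // => a b _ _ ab.
have : a \in porbit 1%g b by rewrite -ab porbit_id.
by case/porbitP => i; rewrite expg1n perm1.
Qed.

Lemma cycle_weightM (K : comNzRingType) (T : finType) (y : K) (U : {set T})
    (s : {perm T}) (l m : T) :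
  perm_on U s -> m \notin U -> l != m ->
  cycle_weight y (s * tperm l m)%g = y * cycle_weight y s.
Proof.
move=> sU mU lm; rewrite /cycle_weight -exprS; congr (_ ^+ _).
have := card_porbits_mul_tperm sU mU lm; have := card_porbits_le s; lia.
Qed.

(** One Jucys-Murphy factor: enlarging U by m composes with 1 + y J_m, where J_m is the sum of the
    [tperm l m] over l in U. *)
Lemma sum_cycle_weightU1 (K : comNzRingType) (T : finType) (y : K)
    (U : {set T}) (m : T) (G : {perm T} -> K) : m \notin U ->
  \sum_(s | perm_on (m |: U) s) cycle_weight y s * G s =
  \sum_(s | perm_on U s) cycle_weight y s * G s +
  y * \sum_(l in U) \sum_(s | perm_on U s) cycle_weight y s * G (s * tperm l m)%g.
Proof.
move=> mU; rewrite big_perm_onU1 // big_setU1 //=; congr (_ + _).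
  by apply: eq_bigr => s _; rewrite tperm1 mulg1.
rewrite mulr_sumr; apply: eq_bigr => l lU; rewrite mulr_sumr.
apply: eq_bigr => s sU; rewrite mulrA (cycle_weightM _ sU) //.
by apply: contraNneq mU => <-.
Qed.

(** Transpositions act as -1 on the sign character, so a point added to a set of i points
    contributes the factor 1 - i y. *)
Lemma sum_cycle_weight_sign (K : comNzRingType) (T : finType) (y : K)
    (U : {set T}) :
  \sum_(s | perm_on U s) cycle_weight y s * (-1) ^+ s =
  \prod_(i < #|U|) (1 - i%:R * y).
Proof.
move: {2}#|U| (erefl #|U|) => n; elim: n U => [|n IH] U.
  move/eqP; rewrite cards_eq0 => /eqP ->; rewrite cards0 big_ord0.
  rewrite (big_pred1 1%g) ?cycle_weight1 ?odd_perm1 ?mul1r // => s /=.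
  apply/idP/eqP => [s0|->]; last exact: perm_on1.
  by apply/permP => a; rewrite perm1 (out_perm s0) // inE.
move=> Un.
have [m mU] : exists m, m \in U by apply/set0Pn; rewrite -card_gt0 Un.
have mU' : m \notin U :\ m by rewrite !inE eqxx.
have Un' : #|U :\ m| = n by move: Un; rewrite (cardsD1 m) mU => -[].
have eqU := setD1K mU.
rewrite -[in LHS]eqU sum_cycle_weightU1 // Un big_ord_recr /= -Un' -IH //.
rewrite mulrBr mulr1; congr (_ + _).
rewrite (eq_bigr (fun=> - \sum_(s | perm_on (U :\ m) s)
    cycle_weight y s * (-1) ^+ s)) => [|l lU].
  by rewrite sumr_const mulNrn mulrN -[X in y * X]mulr_natl [in RHS]mulrC -mulrA mulrCA.
rewrite -sumrN; apply: eq_bigr => s _.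
have lm : l != m by move: lU; rewrite !inE => /andP[].
by rewrite odd_permM odd_tperm lm addbT signrN mulrN.
Qed.

Definition upd (T : finType) (l q : T) : T -> T := fun i => if i == l then q else i.

(* [F f] stands for an alternating form in the rows picked by [f] inside [S].
   Enlarging [U] by a point m composes with 1 + y * \sum_(l in U) tperm l m;
   the terms where two rows of S get replaced cancel by antisymmetry. *)
Lemma sum_cycle_weight_alternating (K : numFieldType) (T : finType) (y : K)
    (S U : {set T}) (F : (T -> T) -> K) :
  (forall f g, {in S, f =1 g} -> F f = F g) ->
  (forall f s, perm_on S s -> F (f \o (s : {perm T})) = (-1) ^+ s * F f) ->
  S \subset U ->
  \sum_(s | perm_on U s) cycle_weight y s * F s =
  \prod_(i < #|S|) (1 - i%:R * y) * \prod_(i < #|U :\: S|) (1 + i%:R * y) *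
  (F id + y * \sum_(q in U :\: S) \sum_(l in S) F (upd l q)).
Proof.
move: {2}#|U :\: S| (erefl #|U :\: S|) => u; elim: u U F => [|u IH] U F Un Fext Falt SU.
  move/eqP: (Un); rewrite cards_eq0 => /eqP U0; rewrite Un U0 !big_ord0 big_set0.
  have -> : U = S by apply/eqP; rewrite eqEsubset SU -setD_eq0 U0 eqxx.
  rewrite mulr0 addr0 mulr1 -sum_cycle_weight_sign mulr_suml.
  by apply: eq_bigr => s sS; rewrite -mulrA -Falt.
have [m mUS] : exists m, m \in U :\: S by apply/set0Pn; rewrite -card_gt0 Un.
have /andP[mS mU] : (m \notin S) && (m \in U) by move: mUS; rewrite inE.
pose W := U :\ m.
have mW : m \notin W by rewrite !inE eqxx.
have UW : U = m |: W by rewrite setD1K.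
have SW : S \subset W by rewrite subsetD1 SU.
have WS : W :\: S = (U :\: S) :\ m by rewrite /W setDDl setUC -setDDl.
have Wn : #|W :\: S| = u.
  by move: Un; rewrite (cardsD1 m) mUS -WS => -[].
have Wq q : q \in W :\: S -> [/\ q \in W, q \notin S & q != m].
  rewrite inE => /andP[qS qW]; split => //.
  by apply: contraNneq mW => <-.
have Sm l : l \in S -> l != m by move=> lS; apply: contraNneq mS => <-.
rewrite [in LHS]UW sum_cycle_weightU1 // IH // Wn.
pose c := \prod_(i < #|S|) (1 - i%:R * y) * \prod_(i < u) (1 + i%:R * y).
pose Psi q := \sum_(l in S) F (upd l q).
have step l : \sum_(s | perm_on W s) cycle_weight y s * F (s * tperm l m)%g =
   c * (F (tperm l m) + y * \sum_(q in W :\: S) \sum_(l' in S) F (tperm l m \o upd l' q)).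
  rewrite -[RHS]/(_ * ((fun f => F (tperm l m \o f)) id + _)) /c -Wn.
  rewrite -(IH W (fun f => F (tperm l m \o f))) //.
  - apply: eq_bigr => s _; congr (_ * _); apply: Fext => i _.
    by rewrite /= permM.
  - by move=> f g fg; apply: Fext => i iS /=; rewrite fg.
  - by move=> f s sS; rewrite -Falt.
rewrite (eq_bigr _ (fun l _ => step l)).
rewrite -mulr_sumr big_split /= -mulr_sumr.
have E1 : \sum_(l in W) F (tperm l m) = u%:R * F id + Psi m.
  rewrite (bigID [in S]) /= addrC; congr (_ + _).
    rewrite (eq_bigl [in W :\: S]) => [|l]; last by rewrite !inE andbC.
    rewrite (eq_bigr (fun=> F id)) => [|l /Wq[lW lS lm]].
      by rewrite sumr_const Wn mulr_natl.
    apply: Fext => i iS; rewrite tpermD // 1?eq_sym ?Sm //.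
    by apply: contraNneq lS => <-.
  rewrite (eq_bigl [in S]) => [|l]; last first.
    by apply/andP/idP => [[]//|lS]; split => //; apply: (subsetP SW).
  apply: eq_bigr => l lS; apply: Fext => i iS; rewrite /upd.
  by case: tpermP => [->|/eqP|/eqP]; rewrite ?eqxx // ?(negPf (Sm _ iS)) // => /negPf ->.
(* For fixed q, the term l = q moves the replacement from q to m and gives [Psi m]. Each of the u -
   1 other l outside S changes nothing and gives [Psi q]; the l in S together give one more
   [Psi q]. *)
have E2 : \sum_(l in W) \sum_(q in W :\: S) \sum_(l' in S) F (tperm l m \o upd l' q)
   = \sum_(q in W :\: S) (Psi m + u%:R * Psi q).
  rewrite exchange_big /=; apply: eq_bigr => q /[dup] qWS /Wq[qW qS qm].
  rewrite (bigD1 q) //=; congr (_ + _).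
    apply: eq_bigr => l lS; apply: Fext => i iS; rewrite /= /upd.
    case: ifP => _; first by rewrite tpermL.
    by rewrite tpermD // 1?eq_sym ?Sm //; apply: contraNneq qS => <-.
  rewrite (bigID [in S]) /=.
  have u0 : u = u.-1.+1 by rewrite -Wn (cardsD1 q) qWS.
  rewrite u0 -addn1 natrD mulrDl mul1r addrC; congr (_ + _).
    rewrite (eq_bigr (fun=> Psi q)) => [|l /andP[/andP[lW lq] lS]].
      rewrite (eq_bigl [in (W :\: S) :\ q]) => [|l]; last first.
        by rewrite !inE; case: (l == q) (l \in S) => -[] //=; rewrite ?andbF ?andbT.
      rewrite sumr_const mulr_natl; congr (_ *+ _).
      by move: Wn; rewrite (cardsD1 q) qWS => <-.
    apply: eq_bigr => l' lS'; apply: Fext => i iS; rewrite /= /upd.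
    have lm : l != m by apply: contraNneq mW => <-.
    case: ifP => _; first by rewrite tpermD // eq_sym.
    rewrite tpermD // 1?eq_sym ?Sm //.
    by apply: contraNneq lS => <-.
  rewrite (eq_bigl [in S]) => [|l]; last first.
    apply/andP/idP => [[]//|lS]; split => //; rewrite (subsetP SW) //=.
    by apply: contraNneq qS => <-.
  (* For l <> l', row l is replaced by m and row l' by q. Exchanging l and l' swaps these two rows
     and changes the sign, so the double sum is its own opposite. The diagonal terms only see the
     replacement of l by q. *)
  pose a l l' := if l == l' then 0 else F (tperm l m \o upd l' q).
  have -> : \sum_(l in S) \sum_(l' in S) F (tperm l m \o upd l' q) =
     Psi q + \sum_(l in S) \sum_(l' in S) a l l'.
    rewrite -big_split /=; apply: eq_bigr => l lS.
    rewrite (bigD1 l) //= [X in _ = _ + X](bigD1 l) //= {1}/a eqxx add0r; congr (_ + _).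
      apply: Fext => i iS; rewrite /= /upd; case: eqP => [_|il].
        rewrite tpermD //; last by rewrite eq_sym.
        by apply: contraNneq qS => <-.
      by rewrite tpermD // 1?eq_sym ?Sm //; apply/eqP.
    apply: eq_bigr => l' /andP[_ ll']; rewrite /a eq_sym.
    by rewrite eq_sym in ll'; rewrite eq_sym (negPf ll').
  rewrite -[RHS]addr0; congr (_ + _).
  have asym l l' : l \in S -> l' \in S -> a l l' = - a l' l.
    move=> lS lS'; rewrite /a; rewrite eq_sym; case: eqP => [|/eqP ll]; first by rewrite oppr0.
    have tS : perm_on S (tperm l l').
      by apply: subset_trans (tperm_on _ _) _; rewrite subUset !sub1set lS.
    rewrite -mulN1r -[-1](_ : (-1) ^+ tperm l l' = -1); last first.
      by rewrite odd_tperm eq_sym ll.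
    rewrite -Falt //; apply: Fext => i iS; rewrite /= /upd.
    have lq : l != q by apply: contraNneq qS => <-.
    have lq' : l' != q by apply: contraNneq qS => <-.
    have lm := Sm _ lS; have lm' := Sm _ lS'; have im := Sm _ iS.
    have ll' : l != l' by rewrite eq_sym.
    have [->|il] := eqVneq i l.
      by rewrite (negPf ll') tpermL [tperm l l' l]tpermL (negPf ll) tpermL.
    have [->|il'] := eqVneq i l'.
      by rewrite tpermR eqxx !tpermD // eq_sym.
    have -> : tperm l l' i = i by rewrite tpermD // eq_sym.
    by rewrite (negPf il) !tpermD // eq_sym.
  have : \sum_(l in S) \sum_(l' in S) a l l' = - \sum_(l in S) \sum_(l' in S) a l l'.
    rewrite [in RHS]exchange_big /= -sumrN; apply: eq_bigr => l lS.
    by rewrite -sumrN; apply: eq_bigr => l' lS'; apply: asym.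
  by move/eqP; rewrite -subr_eq0 opprK -mulr2n mulrn_eq0 /= => /eqP.
rewrite E1 E2 big_split /= -mulr_sumr sumr_const Wn.
rewrite (big_setD1 m mUS) /= -WS -/(Psi m) Un big_ord_recr /= -/c.
rewrite -/(\sum_(q in W :\: S) Psi q) /c -[Psi m *+ u]mulr_natl.
set X := \sum_(q in _) Psi q; ring.
Qed.

(** * Determinants with mixed rows and the hook functionals *)

Definition mix_rows (K : comNzRingType) k (S : {set 'I_k}) (Y M : 'M[K]_k)
    (f : 'I_k -> 'I_k) : 'M[K]_k :=
  \matrix_(i, j) if i \in S then M (f i) j else Y i j.

Lemma det_sum_row (K : comNzRingType) k (I : finType) (l : 'I_k)
    (A : I -> 'M[K]_k) (B : 'M[K]_k) :
  (forall q i j, i != l -> A q i j = B i j) ->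
  (forall j, B l j = \sum_q A q l j) ->
  \det B = \sum_q \det (A q).
Proof.
move=> AB Bl; rewrite (expand_det_row _ l).
under [RHS]eq_bigr => q _ do rewrite (expand_det_row _ l).
rewrite exchange_big /=; apply: eq_bigr => j _; rewrite Bl mulr_suml.
apply: eq_bigr => q _; congr (_ * _); rewrite /cofactor; congr (_ * \det _).
by apply/matrixP => a b; rewrite !mxE AB // eq_sym neq_lift.
Qed.

(** Summing over all q the determinants with row l replaced by row q of M makes row l equal to row
    i0, so the sum is 0. Among the q in S only q = l avoids a repeated row. Hence the q outside S
    contribute -F(id) for each l in S, and the last factor of [sum_cycle_weight_alternating] becomes
    1 - #|S| y. *)
Lemma sum_cycle_weight_mix_rows (K : numFieldType) k (y : K) (S : {set 'I_k})
    (i0 : 'I_k) (Y M : 'M[K]_k) :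
  i0 \notin S -> (forall j, Y i0 j = \sum_q M q j) ->
  \sum_(s : 'S_k) cycle_weight y s * \det (mix_rows S Y M s) =
  \prod_(i < #|S|.+1) (1 - i%:R * y) * \prod_(i < k - #|S|) (1 + i%:R * y) *
  \det (mix_rows S Y M id).
Proof.
move=> i0S Yi0.
pose F f := \det (mix_rows S Y M f).
have Fext f g : {in S, f =1 g} -> F f = F g.
  move=> fg; congr (\det _); apply/matrixP => i j; rewrite !mxE.
  by case: ifP => // iS; rewrite fg.
have Falt f s : perm_on S s -> F (f \o (s : 'S_k)) = (-1) ^+ s * F f.
  move=> sS; rewrite /F -det_perm -det_mulmx -row_permE; congr (\det _).
  apply/matrixP => i j; rewrite !mxE perm_closed //.
  by case: ifP => // iS; rewrite (out_perm sS) // iS.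
have F0 f a b : a \in S -> b \in S -> a != b -> f a = f b -> F f = 0.
  move=> aS bS ab fab; rewrite /F; apply: (determinant_alternate ab) => j.
  by rewrite !mxE aS bS fab.
have Fw l : l \in S -> \sum_q F (upd l q) = 0.
  move=> lS; pose B := \matrix_(i, j) if i == l then Y i0 j else mix_rows S Y M id i j.
  rewrite -(@det_sum_row _ _ _ l _ B).
  - have li0 : l != i0 by apply: contraNneq i0S => <-.
    apply: (determinant_alternate li0) => j; rewrite !mxE eqxx.
    by rewrite eq_sym (negPf li0) (negPf i0S).
  - by move=> q i j il; rewrite !mxE (negPf il) /upd (negPf il).
  - by move=> j; rewrite !mxE eqxx Yi0; apply: eq_bigr => q _; rewrite !mxE lS /upd eqxx.
rewrite (eq_bigl (fun s : 'S_k => perm_on setT s)); last first.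
  by move=> s; apply/esym/subsetP => i; rewrite inE.
rewrite (sum_cycle_weight_alternating y Fext Falt (subsetT S)).
have -> : \sum_(q in [set: 'I_k] :\: S) \sum_(l in S) F (upd l q) = - (#|S|%:R * F id).
  rewrite exchange_big /= mulr_natl -sumr_const -sumrN; apply: eq_bigr => l lS.
  apply/eqP; rewrite -subr_eq0 opprK; apply/eqP; rewrite -[RHS](Fw l lS).
  rewrite [RHS](bigID [in S]) /= addrC; congr (_ + _).
    by apply: eq_bigl => q; rewrite !inE andbT.
  rewrite (bigD1 l) //= big1 ?addr0; last first.
    move=> q /andP[qS ql]; apply: (F0 _ l q); rewrite // 1?eq_sym //.
    by rewrite /upd eqxx (negPf ql).
  by apply: Fext => i _; rewrite /upd; case: eqP.
have -> : #|[set: 'I_k] :\: S| = (k - #|S|)%N.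
  by rewrite setTD cardsCs setCK card_ord.
rewrite big_ord_recr /= -/(F id); set P1 := \prod_(i < _) _; set P2 := \prod_(i < _) _.
ring.
Qed.

Lemma det_mix_rows_sum (K : comNzRingType) k (Y M : 'M[K]_k) :
  \det (Y + M) = \sum_(S : {set 'I_k}) \det (mix_rows S Y M id).
Proof.
rewrite /determinant exchange_big /=; apply: eq_bigr => s _.
rewrite -mulr_sumr; congr (_ * _).
under eq_bigr => i _ do rewrite mxE addrC.
rewrite bigA_distr /=; apply: eq_bigr => S _; apply: eq_bigr => i _.
by rewrite mxE; case: ifP.
Qed.

Lemma det_mix_rowsZ (K : comNzRingType) k (S : {set 'I_k}) (a : K) (Y M : 'M[K]_k) f :
  \det (mix_rows S Y (a *: M) f) = a ^+ #|S| * \det (mix_rows S Y M f).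
Proof.
rewrite /determinant mulr_sumr; apply: eq_bigr => s _; rewrite mulrCA; congr (_ * _).
rewrite -prodr_const [X in _ = X * _]big_mkcond /= -big_split /=.
by apply: eq_bigr => i _; rewrite !mxE; case: ifP; rewrite ?mul1r.
Qed.

Section HookMinor.
Variables (K : numFieldType) (k : nat).
Implicit Types (S : {set 'I_k.+1}) (s t : 'S_k.+1).

(** The row of ones is the sum of the rows of any permutation matrix, as [sum_cycle_weight_mix_rows]
    asks of row [i0]. It also amounts to working modulo constant vectors. *)
Definition hook_base : 'M[K]_k.+1 :=
  \matrix_(i, j) if i == ord0 then 1 else (i == j)%:R.

(* Averaged over conjugacy classes, for [ord0 \notin S] and r = #|S|, this is the
   normalized character of the hook (k.+1 - r, 1^r). *)
Definition hook_minor S s : K := \det (mix_rows S hook_base (perm_mx s) id).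

(** The product of 1 + c y over the contents c of the hook: first its column, then its row. The
    corner is counted in both, harmlessly, since its content is 0. *)
Definition hook_factor (y : K) (r : nat) : K :=
  \prod_(i < r.+1) (1 - i%:R * y) * \prod_(i < k.+1 - r) (1 + i%:R * y).

Lemma sum_cycle_weight_hook_minor (y : K) S s : ord0 \notin S ->
  \sum_t cycle_weight y t * hook_minor S (t * s)%g =
  hook_factor y #|S| * hook_minor S s.
Proof.
move=> S0; rewrite -(@sum_cycle_weight_mix_rows _ _ y S ord0) //.
  apply: eq_bigr => t _; congr (_ * \det _); apply/matrixP => i j.
  by rewrite !mxE permM.
move=> j; rewrite [LHS]mxE (bigD1 (s^-1 j)%g) //= !mxE permKV eqxx big1 ?addr0 // => q qj.
by rewrite !mxE; case: eqP => // sq; case/eqP: qj; rewrite -sq permK.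
Qed.

Lemma hook_minor1 S : ord0 \notin S -> hook_minor S 1%g = 1.
Proof.
move=> S0; rewrite /hook_minor -det_tr det_trig; last first.
  apply/is_trig_mxP => i j ij; rewrite !mxE perm1.
  have ji : j != i by apply: contraTneq ij => ->; rewrite ltnn.
  case: ifP => _; first by rewrite (negPf ji).
  by rewrite (negPf ji); case: eqP ij => // ->.
apply: big1 => i _; rewrite !mxE perm1 eqxx.
by case: ifP => // _; case: ifP.
Qed.

(** This is det(1 - s) on the permutation representation modulo constants; it vanishes when [s] has
    an invariant vector there, that is, a second orbit. *)
Definition one_cycle_det s : K :=
  \det (\matrix_(i < k.+1, j < k.+1)
    (if i == ord0 then 1 else (i == j)%:R - (s i == j)%:R)).

(** Multilinear expansion of the rows e_i - e_(s i), where S is the set of rows in which the second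
    term is chosen; it is the identity between det(1 - s) and the alternating sum of traces on
    exterior powers. *)
Lemma one_cycle_det_hook s :
  one_cycle_det s = \sum_(S : {set 'I_k.+1} | ord0 \notin S)
    (-1) ^+ #|S| * hook_minor S s.
Proof.
rewrite /one_cycle_det.
pose M : 'M[K]_k.+1 := \matrix_(i, j) if i == ord0 then 0 else perm_mx s i j.
have -> : \matrix_(i, j) (if i == ord0 then 1 else (i == j)%:R - (s i == j)%:R) =
   hook_base + (-1) *: M.
  by apply/matrixP => i j; rewrite !mxE; case: ifP => _; rewrite ?mulr0 ?addr0 ?mulN1r.
rewrite det_mix_rows_sum [RHS]big_mkcond /=; apply: eq_bigr => S _.
rewrite det_mix_rowsZ; case: ifPn => S0.
  congr (_ * \det _); apply/matrixP => i j; rewrite !mxE; case: ifP => // iS.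
  by case: eqP iS S0 => // -> ->.
rewrite (expand_det_row _ ord0) big1 ?mulr0 // => j _.
by rewrite !mxE -(negbK (_ \in S)) S0 eqxx mul0r.
Qed.

Lemma one_cycle_det_eq0 s : porbit s ord0 != setT -> one_cycle_det s = 0.
Proof.
move=> sT; rewrite /one_cycle_det -det_tr; apply/eqP/det0P.
(* The vector [v] is constant on orbits, so the rows i <> 0 kill it. Its two values are chosen so
   that its entries sum to 0, so row 0 kills it as well. *)
pose O := porbit s ord0.
pose v : 'rV[K]_k.+1 := \row_i if i \in O then - #|~: O|%:R else #|O|%:R.
have sO i : (s i \in O) = (i \in O).
  by rewrite /O porbit_sym -{2}[s]expg1 porbit_perm porbit_sym.
have [b bO] : exists b, b \notin O.
  by move: sT; rewrite -subTset => /subsetPn[b _ bO]; exists b.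
exists v.
  apply/eqP => /rowP/(_ b); rewrite !mxE (negPf bO) => /eqP.
  by rewrite pnatr_eq0 cards_eq0 => /eqP/setP/(_ ord0); rewrite porbit_id inE.
apply/rowP => i; rewrite !mxE.
have [->|i0] := eqVneq i ord0.
  rewrite (bigID [in O]) /=.
  rewrite (eq_bigr (fun=> - #|~: O|%:R)) => [|j jO]; last by rewrite !mxE jO mulr1.
  rewrite [X in _ + X](eq_bigr (fun=> #|O|%:R)) => [|j jO]; last first.
    by rewrite !mxE (negPf jO) mulr1.
  rewrite sumr_const (eq_bigl [in ~: O]) => [|j]; last by rewrite inE.
  by rewrite sumr_const mulNrn -!mulrnA (mulnC #|O|) addNr.
under eq_bigr => j _ do rewrite !mxE (negPf i0) mulrBr.
rewrite sumrB /= (bigD1 i) //= eqxx mulr1 big1 ?addr0; last first.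
  by move=> j ji; rewrite eq_sym (negPf ji) mulr0.
rewrite (bigD1 (s i)) //= eqxx mulr1 [X in _ - (_ + X)]big1 ?addr0; last first.
  by move=> j ji; rewrite eq_sym (negPf ji) mulr0.
by rewrite sO subrr.
Qed.

(** At y = 1 the weight is constantly 1, and [hook_factor] contains the factor 1 - y as soon as S is
    nonempty. Only the empty S is left, with the product of the 1 + i. The total mass is enough
    later on, because [perm_trace] takes the same value at all full cycles. *)
Lemma sum_one_cycle_det : \sum_s one_cycle_det s = (k.+1)`!%:R.
Proof.
under eq_bigr => s _ do rewrite one_cycle_det_hook.
rewrite exchange_big /= (bigD1 set0) ?inE //= [X in _ + X]big1 ?addr0; last first.
  move=> S /andP[S0 Sn0]; rewrite -mulr_sumr.
  have := sum_cycle_weight_hook_minor 1 1%g S0; rewrite hook_minor1 // mulr1.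
  under eq_bigr => t _ do rewrite mulg1 /cycle_weight expr1n mul1r.
  move=> ->; rewrite /hook_factor.
  have : (1 < #|S|.+1)%N by rewrite ltnS card_gt0.
  by move=> h; rewrite (bigD1 (Ordinal h)) //= mul1r subrr !mul0r mulr0.
rewrite -mulr_sumr cards0 expr0 mul1r.
have S0 : ord0 \notin (set0 : {set 'I_k.+1}) by rewrite inE.
have := sum_cycle_weight_hook_minor 1 1%g S0; rewrite hook_minor1 // mulr1.
under eq_bigr => t _ do rewrite mulg1 /cycle_weight expr1n mul1r.
move=> ->; rewrite /hook_factor cards0 big_ord1 mul0r subr0 mul1r subn0.
rewrite fact_prod natr_prod big_add1 /= big_mkord; apply: eq_bigr => i _.
by rewrite mulr1 -natr1 addrC.
Qed.

End HookMinor.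

(** * Traces along a permutation, and the pairings of the Wick formula *)

Fixpoint path_weight (K : pzRingType) (I : Type) (A : I -> I -> K) (u : I) (s : seq I) : K :=
  if s is x :: s' then A u x * path_weight A x s' else 1.

Lemma big_tuple_cons (V : nmodType) (I : finType) n (G : n.+1.-tuple I -> V) :
  \sum_t G t = \sum_x \sum_(s : n.-tuple I) G [tuple of x :: s].
Proof.
rewrite pair_bigA /=; apply: (reindex (fun p : I * n.-tuple I => [tuple of p.1 :: p.2])).
exists (fun t => (thead t, [tuple of behead t])) => [[x s] _|t _] /=.
  by rewrite theadE; congr (_, _); apply: val_inj.
by rewrite -tuple_eta.
Qed.

Lemma mx_exp_path_weight (K : comNzRingType) m (A : 'M[K]_m) n u v :
  (A ^+ n) u v = \sum_(t : n.-tuple 'I_m) path_weight A u t * (last u t == v)%:R.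
Proof.
elim: n u => [|n IH] u.
  rewrite expr0 (big_pred1 [tuple]) => [|t]; last by apply/esym/eqP/val_inj; case: t => -[].
  by rewrite /= mul1r mxE.
rewrite exprS mxE big_tuple_cons; apply: eq_bigr => x _.
by rewrite IH mulr_sumr; apply: eq_bigr => t _; rewrite /= mulrA.
Qed.

(** For a matrix A this is the product of the traces of A^c over the cycle lengths c of [s]; at a
    full cycle it is the trace that is wanted. *)
Definition perm_trace (K : comNzRingType) (I T : finType) (A : I -> I -> K) (s : {perm T}) : K :=
  \sum_(i : {ffun T -> I}) \prod_a A (i a) (i (s a)).

Lemma path_weight_traject (K : comNzRingType) (I T : Type) (A : I -> I -> K)
    (f : T -> T) (i : T -> I) x n :
  path_weight A (i x) (map i (traject f (f x) n)) =
  \prod_(a < n) A (i (iter a f x)) (i (f (iter a f x))).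
Proof.
elim: n x => [|n IH] x /=; first by rewrite big_ord0.
rewrite big_ord_recl IH; congr (_ * _); apply: eq_bigr => a _.
by rewrite /= -iterSr.
Qed.

Lemma perm_trace_one_cycle (K : comNzRingType) m k (A : 'M[K]_m) (s : 'S_k.+1) :
  porbit s ord0 = setT -> perm_trace A s = \tr (A ^+ k.+1).
Proof.
move=> sT.
have cs : #|porbit s ord0| = k.+1 by rewrite sT cardsT card_ord.
have us : uniq (traject s ord0 k.+1) by have := uniq_traject_porbit s ord0; rewrite cs.
have inT b : b \in traject s ord0 k.+1 by have := porbit_traject s ord0 b; rewrite cs sT inE => <-.
have sk : iter k.+1 s ord0 = ord0 by have := iter_porbit s ord0; rewrite cs.
pose e (a : 'I_k.+1) := iter a s ord0.
have einj : injective e.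
  move=> a b ab; apply/ord_inj/eqP.
  rewrite -(nth_uniq ord0 _ _ us) ?size_traject //.
  by rewrite !nth_traject //; apply/eqP.
have ebij : bijective e by apply: injF_bij.
have size_tr (i : {ffun 'I_k.+1 -> 'I_m}) : size (map i (traject s (s ord0) k.+1)) == k.+1.
  by rewrite size_map size_traject.
(* The tuple lists the values of i at s 0, s^2 0, and so on. It ends with the value at 0 itself,
   hence describes a closed path from i 0. *)
pose tup i : k.+1.-tuple 'I_m := Tuple (size_tr i).
have lasttup u (i : {ffun 'I_k.+1 -> 'I_m}) : last u (tup i) = i ord0.
  by rewrite /= last_map; congr (i _); rewrite last_traject -iterSr sk.
have tup_inj : injective tup.
  move=> i j ij; apply/ffunP => b.
  have /eq_in_map ij' : map i (traject s (s ord0) k.+1) = map j (traject s (s ord0) k.+1).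
    exact: (congr1 val ij).
  apply: ij'.
  have /trajectP[[|a] ak ->] := inT b.
    by apply/trajectP; exists k; rewrite // -iterSr sk.
  by apply/trajectP; exists a; rewrite 1?ltnW // -iterSr.
have tup_bij : bijective tup.
  by apply: inj_card_bij tup_inj _; rewrite card_tuple card_ffun !card_ord.
rewrite /mxtrace.
under eq_bigr => u _ do rewrite mx_exp_path_weight.
rewrite exchange_big /= (reindex tup); last exact: onW_bij.
apply: eq_bigr => i _.
under [RHS]eq_bigr => u _ do rewrite lasttup.
rewrite [RHS](bigD1 (i ord0)) //= [X in _ + X]big1 ?addr0; last first.
  by move=> u ui; rewrite eq_sym (negPf ui) mulr0.
rewrite eqxx mulr1.
have := path_weight_traject A s i ord0 k.+1; rewrite /= => ->.
rewrite (reindex e) //=; exact: onW_bij.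
Qed.

Lemma perm_trace_mx_exp (K : numFieldType) m k (A : 'M[K]_m) :
  \sum_(S : {set 'I_k.+1} | ord0 \notin S) (-1) ^+ #|S| *
    \sum_(s : 'S_k.+1) hook_minor K S s * perm_trace A s =
  (k.+1)`!%:R * \tr (A ^+ k.+1).
Proof.
rewrite -sum_one_cycle_det mulr_suml.
under eq_bigr => S _ do rewrite mulr_sumr.
rewrite exchange_big /=; apply: eq_bigr => s _.
under eq_bigr => S _ do rewrite mulrA.
rewrite -mulr_suml -one_cycle_det_hook.
have [sT|sT] := eqVneq (porbit s ord0) setT; first by rewrite perm_trace_one_cycle.
by rewrite one_cycle_det_eq0 // !mul0r.
Qed.

Lemma prod_natr_bool (K : comNzRingType) (T : finType) (b : pred T) :
  \prod_a (b a)%:R = [forall a, b a]%:R :> K.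
Proof.
case: forallP => [h|/forallP]; first by apply: big1 => a _; rewrite h.
by rewrite negb_forall => /existsP[a /negPf ba]; rewrite (bigD1 a) //= ba mul0r.
Qed.

Lemma card_ffun_perm_invariant (T I : finType) (s : {perm T}) :
  #|[pred m : {ffun T -> I} | [forall a, m (s a) == m a]]| = (#|I| ^ #|porbits s|)%N.
Proof.
pose Q := {B | B \in porbits s}.
have cls a : porbit s a \in porbits s by apply: imset_f.
have -> : #|porbits s| = #|{: Q}| by rewrite card_sig; apply: eq_card.
rewrite -card_ffun.
pose h (g : {ffun Q -> I}) : {ffun T -> I} :=
  [ffun a => g (exist _ (porbit s a) (cls a))].
have h_inj : injective h.
  move=> g g' gg'; apply/ffunP => -[B BQ]; have /imsetP[a _ Ba] := BQ.
  have := congr1 (fun f : {ffun T -> I} => f a) gg'; rewrite !ffunE.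
  suff -> : exist _ (porbit s a) (cls a) = exist (fun B => B \in porbits s) B BQ by [].
  by apply: val_inj.
rewrite -(card_codom h_inj); apply: eq_card => m; rewrite !inE.
apply/forallP/codomP => [mi|[g ->] a]; last first.
  rewrite !ffunE; apply/eqP; congr (g _); apply: val_inj => /=.
  by rewrite -{2}[s]expg1 porbit_perm.
have mi' a b : b \in porbit s a -> m b = m a.
  case/porbitP => i ->; elim: i => [|i IH]; first by rewrite perm1.
  by rewrite expgSr permM (eqP (mi _)).
have Qex (B : Q) : exists a, a \in sval B.
  by case: B => B /= /imsetP[a _ ->]; exists a; apply: porbit_id.
exists [ffun B => m (xchoose (Qex B))]; apply/ffunP => a; rewrite !ffunE.
by apply/esym/mi'; apply: (xchooseP (Qex (exist _ _ _))).
Qed.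

(** The substitution of m composed with the inverse of t for m turns the condition into invariance
    under s t^-1, that is, a free value on each orbit. This is where x^(#cycles) enters, with x the
    range of a matrix index. *)
Lemma sum_perm_invariant (K : comNzRingType) (T I : finType) (s t : {perm T}) :
  \sum_(m : {ffun T -> I}) \prod_a (m (s a) == m (t a))%:R =
  #|I|%:R ^+ #|porbits (s * t^-1)%g| :> K.
Proof.
rewrite -natrX -card_ffun_perm_invariant -sum1_card natr_sum [RHS]big_mkcond /=.
rewrite (reindex (fun m : {ffun T -> I} => [ffun a => m (t^-1 a)%g])) /=; last first.
  by exists (fun m : {ffun T -> I} => [ffun a => m (t a)]) => m _;
     apply/ffunP => a; rewrite !ffunE ?permK ?permKV.
apply: eq_bigr => m _; rewrite prod_natr_bool inE.
under eq_forallb => a do rewrite !ffunE permK -permM.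
by case: ifP.
Qed.

Lemma big_lift_perm (V : nmodType) n (G : 'S_n.+1 -> V) i0 :
  \sum_s G s = \sum_i \sum_(s : 'S_n) G (lift_perm i0 i s).
Proof.
rewrite pair_bigA /=.
pose h (p : 'I_n.+1 * 'S_n) := lift_perm i0 p.1 p.2.
rewrite (reindex h) //=; apply: onW_bij; apply: inj_card_bij.
  move=> [i s] [j t] /permP st; have := st i0; rewrite !lift_perm_id /= => ij.
  rewrite ij; congr (_, _); apply/permP => a; have := st (lift i0 a).
  by rewrite !lift_perm_lift /= ij => /lift_inj.
by rewrite card_prod !card_Sn card_ord factS.
Qed.

(** Left: the shape of a moment of independent complex Gaussian variables, when f and g list the
    plain and the conjugated factors. Right: the number of pairings of equal variables. The
    induction chooses the partner of the factor [ord0] of g. *)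
Lemma prod_fact_fibers (K : numFieldType) (I : finType) k (f g : 'I_k -> I) :
  \prod_e ((#|[pred a | f a == e]| == #|[pred a | g a == e]|)%:R *
           (#|[pred a | f a == e]|)`!%:R) =
  \sum_(s : 'S_k) \prod_a (f (s a) == g a)%:R :> K.
Proof.
elim: k f g => [|k IH] f g.
  rewrite big1 => [|e _]; last first.
    by rewrite !eq_card0 ?eqxx ?mul1r // => -[].
  rewrite (big_pred1 1%g) ?big_ord0 // => s /=.
  by apply/esym/eqP/permP => -[].
rewrite (big_lift_perm _ ord0).
have cardE' n (h : 'I_n -> I) e : #|[pred a | h a == e]| = (\sum_(a < n) (h a == e))%N.
  by rewrite -sum1_card big_mkcond /=; apply: eq_bigr => a _; rewrite /in_mem /=; case: eqP.
have cardS (h : 'I_k.+1 -> I) (i : 'I_k.+1) e :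
    #|[pred a | h a == e]| = ((h i == e) + #|[pred a | h (lift i a) == e]|)%N.
  by rewrite !cardE' (bigD1_ord i).
pose L (h : 'I_k.+1 -> I) e := #|[pred a : 'I_k.+1 | h a == e]|.
have step i : \sum_(s : 'S_k) \prod_a (f (lift_perm ord0 i s a) == g a)%:R =
   (f i == g ord0)%:R * \prod_e ((L f e == L g e)%:R *
      (#|[pred a | f (lift i a) == e]|)`!%:R) :> K.
  rewrite (eq_bigr (fun s : 'S_k => (f i == g ord0)%:R *
      \prod_a (f (lift i (s a)) == g (lift ord0 a))%:R)); last first.
    move=> s _; rewrite big_ord_recl lift_perm_id; congr (_ * _).
    by apply: eq_bigr => a _; rewrite lift_perm_lift.
  rewrite -mulr_sumr.
  rewrite -(IH (fun a => f (lift i a)) (fun a => g (lift ord0 a))).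
  have [fg|] := eqVneq (f i) (g ord0); last by rewrite !mul0r.
  congr (_ * _); apply: eq_bigr => e _; congr (_%:R * _).
  by rewrite /L (cardS f i) (cardS g ord0) fg eqn_add2l.
rewrite (eq_bigr _ (fun i _ => step i)) {step}.
rewrite [LHS](_ : _ = \prod_e (L f e == L g e)%:R * \prod_e (L f e)`!%:R); last first.
  by rewrite -big_split.
under [RHS]eq_bigr => i _ do rewrite big_split /= mulrCA.
rewrite -mulr_sumr.
case: (boolP [forall e, L f e == L g e]) => [fg|/forallPn[e fge]]; last first.
  by rewrite (bigD1 e) //= (negPf fge) !mul0r.
congr (_ * _); set e0 := g ord0.
have Lf0 : (0 < L f e0)%N.
  by rewrite (eqP (forallP fg e0)) /L (cardS g ord0) /e0 eqxx.
(* There are L f e0 possible partners i, and each leaves a fiber with one element less over e0: n (n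
   - 1)! = n!. *)
rewrite (eq_bigr (fun i => (f i == e0)%:R * ((L f e0).-1)`!%:R *
    \prod_(e | e != e0) (L f e)`!%:R)); last first.
  move=> i _; have [fi|] := eqVneq (f i) e0; last by rewrite !mul0r.
  rewrite !mul1r (bigD1 e0) //=; congr (_ * _).
    by congr (_`!%:R); rewrite /L (cardS f i) fi eqxx.
  apply: eq_bigr => e ee; congr (_`!%:R).
  by rewrite /L (cardS f i) fi eq_sym (negPf ee).
rewrite -!mulr_suml (bigD1 e0) //=; congr (_ * _).
rewrite -natr_sum -natrM; congr (_%:R).
have -> : (\sum_(i < k.+1) (f i == e0))%N = L f e0.
  by rewrite /L cardE'.
by rewrite -{1 2}(prednK Lf0) factS.
Qed.

(** * Finite differences of rising products *)

Lemma hook_factor_rising (K : numFieldType) k (x : K) r : x != 0 -> (r <= k)%N ->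
  x ^+ k.+1 * hook_factor k x^-1 r = \prod_(i < k.+1) (x + i%:R - r%:R).
Proof.
move=> x0 rk; rewrite /hook_factor.
have scale n (a : nat -> K) : x ^+ n * \prod_(i < n) (1 + a i * x^-1) = \prod_(i < n) (x + a i).
  rewrite -[X in x ^+ X](card_ord n) -prodr_const -big_split; apply: eq_bigr => i _.
  by rewrite /= mulrDr mulr1 mulrCA divff // mulr1.
(* The hook has k + 1 boxes, whereas the two products have k + 2 factors. The second occurrence of
   the corner, a factor 1, gets no power of x. *)
have -> : (k.+1 = r.+1 + (k - r))%N by lia.
rewrite exprD big_split_ord /= mulrACA; congr (_ * _).
  under eq_bigr => i _ do rewrite -mulNr.
  rewrite (scale _ (fun i => - i%:R)) (reindex_inj rev_ord_inj) /=; apply: eq_bigr => i _.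
  have ir : (i <= r)%N by rewrite -ltnS.
  by rewrite subSS natrB // opprB; ring.
have -> : (r.+1 + (k - r) - r = (k - r).+1)%N by lia.
rewrite big_ord_recl /= mul0r addr0 mul1r.
rewrite (scale _ (fun i => i.+1%:R)); apply: eq_bigr => i _.
by rewrite addSnnS natrD; ring.
Qed.

Lemma sum_sets_card (V : nmodType) k (g : nat -> V) :
  \sum_(S : {set 'I_k.+1} | ord0 \notin S) g #|S| = \sum_(r < k.+1) g r *+ 'C(k, r).
Proof.
have cB : #|~: [set (ord0 : 'I_k.+1)]| = k by rewrite cardsCs setCK cards1 card_ord subn1.
have Sle (S : {set 'I_k.+1}) : ord0 \notin S -> (#|S| < k.+1)%N.
  move=> S0; rewrite ltnS -[X in (_ <= X)%N]cB; apply: subset_leq_card.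
  by apply/subsetP => i iS; rewrite !inE; apply: contraNneq S0 => <-.
rewrite (partition_big (fun S : {set 'I_k.+1} => inord #|S| : 'I_k.+1) xpredT) //=.
apply: eq_bigr => r _.
rewrite (eq_bigr (fun=> g r)); last first.
  by move=> S /andP[/Sle S0 /eqP <-]; rewrite inordK.
rewrite sumr_const; congr (_ *+ _).
have := cards_draws (~: [set (ord0 : 'I_k.+1)]) r; rewrite cB => <-.
rewrite cardsE; apply: eq_card => S; rewrite unfold_in [in RHS]unfold_in.
have -> : (S \subset ~: [set ord0]) = (ord0 \notin S).
  by rewrite subsetC sub1set inE.
apply: andb_id2l => /Sle S0; apply/eqP/eqP => [<-|Sr]; first by rewrite inordK.
by apply: val_inj; rewrite /= inordK.
Qed.

Section FiniteDifference.
Variable K : comNzRingType.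

Lemma coef_comp_XD1 (q : {poly K}) n i : (size q <= n)%N ->
  (q \Po ('X + 1))`_i = \sum_(j < n) q`_j *+ 'C(j, i).
Proof.
move=> qn; rewrite comp_polyE coef_sum.
rewrite (big_ord_widen n (fun j => (q`_j *: ('X + 1) ^+ j)`_i)) // big_mkcond /=.
apply: eq_bigr => j _; case: ltnP => jq; last by rewrite nth_default // mul0rn.
rewrite coefZ -mulr_natr; congr (_ * _).
elim: {j jq} (nat_of_ord j) i => [|j IH] i.
  by rewrite expr0 coef1 bin0n eq_sym.
rewrite exprS mulrDl mul1r coefD coefXM !IH; case: i => [|i] /=; first by rewrite !bin0 add0r.
by rewrite binS natrD addrC.
Qed.

(** By Pascal's rule the k+1-st alternating sum of q is the k-th one of q - q(X + 1). That
    difference has lower degree, with coefficient -(k + 1) times the old top one. *)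
Lemma finite_difference k (q : {poly K}) : (size q <= k.+1)%N ->
  \sum_(r < k.+1) (-1) ^+ r * 'C(k, r)%:R * q.[r%:R] = (-1) ^+ k * k`!%:R * q`_k.
Proof.
elim: k q => [|k IH] q qk.
  by rewrite big_ord1 bin0 fact0 (size1_polyC qk) hornerC coefC.
pose q' := q - (q \Po ('X + 1)).
have cq' i : (k < i)%N -> q'`_i = 0.
  move=> ki; rewrite /q' coefB (coef_comp_XD1 _ qk) big_ord_recr /=.
  rewrite big1 => [|j _]; last by rewrite bin_small // (leq_trans (ltn_ord j)).
  rewrite add0r; have [->|] := eqVneq i k.+1; first by rewrite binn subrr.
  move=> ik; have ki' : (k.+1 < i)%N by lia.
  by rewrite bin_small // mulr0n subr0 nth_default // (leq_trans qk).
have q'k : q'`_k = - (k.+1%:R * q`_k.+1).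
  rewrite /q' coefB (coef_comp_XD1 _ qk) !big_ord_recr /= binn binSn.
  rewrite big1 => [|j _]; last by rewrite bin_small // ltn_ord.
  by rewrite add0r mulr1n opprD addrA subrr sub0r mulr_natl.
have sq' : (size q' <= k.+1)%N by apply/leq_sizeP => i; apply: cq'.
have -> : \sum_(r < k.+2) (-1) ^+ r * 'C(k.+1, r)%:R * q.[r%:R] =
    \sum_(r < k.+1) (-1) ^+ r * 'C(k, r)%:R * q'.[r%:R].
  rewrite /q'.
  under [RHS]eq_bigr => r _ do
    rewrite hornerD hornerN horner_comp hornerD hornerX hornerC mulrBr.
  rewrite sumrB big_ord_recl [X in _ = X - _]big_ord_recl !bin0 -!addrA; congr (_ + _).
  under eq_bigr => r _ do rewrite /= /bump /= add1n binS natrD mulrDr mulrDl.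
  rewrite big_split /= big_ord_recr /= bin_small // mulr0 mul0r addr0.
  congr (_ + _); rewrite -sumrN; apply: eq_bigr => r _.
  by rewrite natr1 exprS; ring.
by rewrite IH // q'k factS natrM exprS; ring.
Qed.

(* As polynomials in the shift ['X], the coefficients of
   [prod_(i < n) (x + i - 'X)] with respect to [x]. *)
Definition shifted_rising n : {poly {poly K}} := \prod_(i < n) ('X + (i%:R - 'X)%:P).

Lemma horner_shifted_rising n (x r : K) :
  (shifted_rising n).[x%:P].[r] = \prod_(i < n) (x + i%:R - r).
Proof.
rewrite /shifted_rising horner_prod horner_prod; apply: eq_bigr => i _.
by rewrite hornerD hornerX hornerC !hornerD !hornerN hornerX hornerC -polyC_natr hornerC addrA.
Qed.

Lemma size_shifted_rising n : (size (shifted_rising n) <= n.+1)%N.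
Proof.
elim: n => [|n IH]; first by rewrite /shifted_rising big_ord0 size_poly1.
rewrite /shifted_rising big_ord_recr /=; apply: leq_trans (size_polyMleq _ _) _.
rewrite size_XaddC addn2 /=; exact: IH.
Qed.

(** In x and the shift together, the product has total degree n and top homogeneous part (x - 'X)^n;
    the bound and the coefficient are read off from it. *)
Lemma coef_shifted_rising n l : (l <= n)%N ->
  (size ((shifted_rising n)`_l)%R <= (n - l).+1)%N /\
  (shifted_rising n)`_l`_(n - l) = (-1) ^+ (n - l) *+ 'C(n, l).
Proof.
elim: n l => [|n IH] l ln.
  move: ln; rewrite leqn0 => /eqP ->; rewrite /shifted_rising big_ord0 coef1 /=.
  by rewrite size_poly1 coef1.
have -> : shifted_rising n.+1 = 'X * shifted_rising n + (n%:R - 'X)%:P * shifted_rising n.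
  by rewrite /shifted_rising big_ord_recr /= mulrC mulrDl.
rewrite coefD coefXM coefCM.
have top : (shifted_rising n)`_n.+1 = 0 by rewrite nth_default // size_shifted_rising.
case: l ln => [|l] ln /=.
  have [] := IH 0 isT; rewrite !subn0 => s0 c0; rewrite add0r mulrBl; split.
    apply: leq_trans (size_polyD _ _) _; rewrite geq_max size_polyN; apply/andP; split.
      by rewrite -polyC_natr mul_polyC; apply: leq_trans (size_scale_leq _ _) (leqW s0).
    by apply: leq_trans (size_polyMleq _ _) _; rewrite size_polyX add2n ltnS.
  rewrite coefB coefXM -polyC_natr coefCM [_`_n.+1]nth_default // mulr0 sub0r /= c0 !bin0.
  by rewrite !mulr1n exprS mulN1r.
have [sl cl] := IH l ln; rewrite subSS.
move: ln; rewrite ltnS leq_eqVlt => /orP[/eqP ->|ln].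
  by rewrite top mulr0 addr0; have := IH n (leqnn n); rewrite subnn !binn.
have [sl' cl'] := IH l.+1 ln; split.
  apply: leq_trans (size_polyD _ _) _; rewrite geq_max sl /= mulrBl.
  apply: leq_trans (size_polyD _ _) _; rewrite geq_max size_polyN; apply/andP; split.
    rewrite -polyC_natr mul_polyC; apply: leq_trans (size_scale_leq _ _) _.
    apply: leq_trans sl' _; lia.
  apply: leq_trans (size_polyMleq _ _) _; rewrite size_polyX add2n ltnS /=.
  apply: leq_trans sl' _; lia.
rewrite coefD cl mulrBl coefB coefXM -polyC_natr coefCM.
have -> : (n - l == 0)%N = false by lia.
have -> : ((n - l).-1 = n - l.+1)%N by lia.
have -> : (shifted_rising n)`_l.+1`_(n - l) = 0.
  by rewrite nth_default //; apply: leq_trans sl' _; lia.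
rewrite mulr0 cl' sub0r binS mulrnDr addrC; congr (_ + _).
have -> : (n - l = (n - l.+1).+1)%N by lia.
by rewrite exprS mulN1r mulNrn.
Qed.

End FiniteDifference.

From mathcomp Require Import all_classical all_reals all_analysis.
From mathcomp Require Import measurable_realfun complex.

Import Order.TTheory GRing.Theory Num.Theory.
Import numFieldNormedType.Exports.

Local Open Scope classical_set_scope.
Local Open Scope ring_scope.

(** * Gaussian moments *)

Section DensityPushforward.
Import HBNNSimple.

(** A common form for three changes of variables: the law of a variable (g = 1), a measure given by
    a density (phi the identity), and one factor among independent ones (g the product of the
    others). *)
Lemma ge0_integral_density_pushforward d d' (R : realType) (T : measurableType d)
    (S : measurableType d') (mu : {measure set T -> \bar R})
    (nu : {measure set S -> \bar R}) (phi : T -> S) (g : T -> R) :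
  measurable_fun setT phi -> measurable_fun setT g -> (forall t, 0 <= g t) ->
  (forall A, measurable A -> \int[mu]_t (g t * \1_A (phi t))%:E = nu A)%E ->
  forall h : S -> R, measurable_fun setT h -> (forall s, 0 <= h s) ->
  (\int[mu]_t (g t * h (phi t))%:E = \int[nu]_s (h s)%:E)%E.
Proof.
move=> mphi mg g0 gnu h mh h0.
pose hE : S -> \bar R := EFin \o h.
have mEh : measurable_fun setT hE by apply/measurable_EFinP.
pose f := nnsfun_approx measurableT mEh.
have f_cvg s : (EFin \o f^~ s) @ \oo --> (h s)%:E.
  by apply: (cvg_nnsfun_approx measurableT mEh) => // t _; rewrite lee_fin.
have f_nd s m n : (m <= n)%N -> f m s <= f n s.
  by move=> mn; have /lefP := nd_nnsfun_approx measurableT mEh mn; apply.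
have mf n : measurable_fun setT (f n) by [].
have mind n r : measurable_fun setT
    (fun t : T => (g t)%:E * (r * \1_(f n @^-1` [set r]) (phi t))%:E)%E.
  apply: emeasurable_funM; first exact/measurable_EFinP.
  apply/measurable_EFinP; apply: measurable_funM => //.
  by apply: measurableT_comp => //; exact: measurable_indic.
have step n : (\int[mu]_t ((g t)%:E * (f n (phi t))%:E) = \int[nu]_s (f n s)%:E)%E.
  rewrite integralT_nnsfun sintegralE.
  transitivity (\int[mu]_t (\sum_(r \in range (f n))
     ((g t)%:E * (r * \1_(f n @^-1` [set r]) (phi t))%:E)))%E.
    apply: eq_integral => t _; rewrite -ge0_mule_fsumr => [|r]; last exact: nnfun_muleindic_ge0.
    by rewrite fsumEFin // -(fimfunE _ (phi t)).
  rewrite ge0_integral_fsum //; last first.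
    by move=> r t _; rewrite mule_ge0 ?lee_fin ?g0 //; exact: nnfun_muleindic_ge0.
  apply: eq_fsbigr => r /[!inE] rf.
  have r0 : 0 <= r by case: rf => s _ <-.
  under eq_integral => t _ do rewrite -EFinM mulrCA EFinM.
  rewrite ge0_integralZl //.
  - by rewrite gnu.
  - apply/measurable_EFinP; apply: measurable_funM => //.
    by apply: measurableT_comp => //; exact: measurable_indic.
  - by move=> t _; rewrite lee_fin mulr_ge0.
have hphi t : (h (phi t))%:E = limn (fun n => (f n (phi t))%:E).
  by apply/esym/cvg_lim => //; exact: f_cvg.
have -> : (\int[mu]_t (g t * h (phi t))%:E =
    limn (fun n => \int[mu]_t ((g t)%:E * (f n (phi t))%:E)))%E.
  rewrite -monotone_convergence //.
  - apply: eq_integral => t _; rewrite EFinM hphi -limeMl //.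
    by apply/cvg_ex; exists (h (phi t))%:E; exact: f_cvg.
  - move=> n; apply: emeasurable_funM; first exact/measurable_EFinP.
    by apply/measurable_EFinP; apply: measurableT_comp.
  - by move=> n t _; rewrite mule_ge0 // lee_fin.
  - by move=> t _ m n mn; rewrite lee_wpmul2l ?lee_fin // f_nd.
under eq_fun => n do rewrite step.
rewrite -monotone_convergence //.
- by apply: eq_integral => s _; apply/cvg_lim => //; exact: f_cvg.
- by move=> n; apply/measurable_EFinP.
- by move=> n s _; rewrite lee_fin.
- by move=> s _ m n mn; rewrite lee_fin f_nd.
Qed.

End DensityPushforward.

Lemma integral_density_pushforward d d' (R : realType) (T : measurableType d)
    (S : measurableType d') (mu : {measure set T -> \bar R})
    (nu : {measure set S -> \bar R}) (phi : T -> S) (g : T -> R) :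
  measurable_fun setT phi -> measurable_fun setT g -> (forall t, 0 <= g t) ->
  (forall A, measurable A -> \int[mu]_t (g t * \1_A (phi t))%:E = nu A)%E ->
  forall h : S -> R, measurable_fun setT h ->
  (\int[mu]_t (g t * h (phi t))%:E = \int[nu]_s (h s)%:E)%E.
Proof.
move=> mphi mg g0 gnu h mh.
rewrite integralE [RHS]integralE.
have tr := @ge0_integral_density_pushforward _ _ _ _ _ _ _ _ _ mphi mg g0 gnu.
have hp : (\int[nu]_s ((fun s => (h s)%:E)^\+ s) = \int[nu]_s (Num.max (h s) 0)%:E)%E.
  by apply: eq_integral => s _; rewrite funeposE EFin_max.
have hn : (\int[nu]_s ((fun s => (h s)%:E)^\- s) = \int[nu]_s (Num.max (- h s) 0)%:E)%E.
  by apply: eq_integral => s _; rewrite funenegE EFin_max.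
rewrite hp hn -tr; last 2 first.
- exact: measurable_maxr.
- by move=> s; rewrite le_max lexx orbT.
rewrite -tr; last 2 first.
- by apply: measurable_maxr => //; apply: measurableT_comp.
- by move=> s; rewrite le_max lexx orbT.
congr (_ - _)%E; apply: eq_integral => t _.
  by rewrite funeposE maxr_pMr // mulr0 EFin_max.
by rewrite funenegE maxr_pMr // mulr0 EFin_max mulrN.
Qed.

Section GaussianMoments.
Variables (R : realType) (s : R).
Hypothesis s0 : s != 0.
Local Notation mu := (@lebesgue_measure R).
Local Notation pdf := (normal_pdf 0 s).

Lemma normal_prob_density (A : set R) : measurable A ->
  (\int[mu]_x (pdf x * \1_A x)%:E = normal_prob 0 s A)%E.
Proof.
move=> mA; rewrite /normal_prob [RHS]integral_mkcond; apply: eq_integral => x _.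
by rewrite epatch_indic EFinM.
Qed.

Lemma exprn_normal_pdf_le n : exists C : R, 0 <= C /\
  forall x, `|x| ^+ n * pdf x <= C * normal_pdf 0 (s *+ 2) x.
Proof.
have s20 : s *+ 2 != 0 by rewrite mulrn_eq0.
have ss : 0 < s ^+ 2 by rewrite exprn_even_gt0.
(* Doubling the standard deviation costs x^2 / (2 s^2) - x^2 / (8 s^2) = x^2 / a in the exponent.
   With t = x^2 / a, the spare factor exp(-t) absorbs |x|^n <= 1 + (a t)^n, because t^n <= n!
   exp(t). This gives D. *)
pose a : R := 8 / 3 * s ^+ 2.
have a0 : 0 < a by rewrite mulr_gt0.
pose D : R := 1 + a ^+ n * n`!%:R.
have D0 : 0 <= D by rewrite addr_ge0 // mulr_ge0 // exprn_ge0 // ltW.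
exists (D * normal_peak s / normal_peak (s *+ 2)); split.
  by rewrite !mulr_ge0 ?invr_ge0 ?normal_peak_ge0.
move=> x; rewrite !normal_pdfE //= [leRHS]mulrA divfK ?gt_eqF ?normal_peak_gt0 //.
rewrite mulrCA [D * _]mulrC -[leRHS]mulrA ler_pM2l ?normal_peak_gt0 //.
rewrite /normal_fun !subr0.
pose t : R := x ^+ 2 / a.
have t0 : 0 <= t by rewrite divr_ge0 ?sqr_ge0 // ltW.
have -> : - x ^+ 2 / (s ^+ 2 *+ 2) = - t - x ^+ 2 / ((s *+ 2) ^+ 2 *+ 2).
  by rewrite /t /a; field.
rewrite mulNr expRD mulrA ler_pM2r ?expR_gt0 // expRN ler_pdivrMr ?expR_gt0 //.
have e1 : 1 <= expR t by rewrite -expR0 ler_expR.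
have et : t ^+ n / n`!%:R <= expR t.
  case: n {D D0} => [|n]; first by rewrite expr0 fact0 divr1.
  by apply: le_trans (expR_ge1Dxn n t0); rewrite lerDr.
have x2 : `|x| ^+ n <= 1 + (x ^+ 2) ^+ n.
  have [x1|/ltW x1] := leP `|x| 1.
    apply: (@le_trans _ _ 1); first by rewrite exprn_ile1.
    by rewrite lerDl exprn_ge0 // sqr_ge0.
  rewrite -(real_normK (num_real x)) -exprM.
  have h : `|x| ^+ n <= `|x| ^+ (2 * n) by rewrite ler_weXn2l // leq_pmull.
  by apply: le_trans h _; rewrite lerDr.
apply: le_trans x2 _; rewrite mulrDl mul1r lerD //.
have -> : x ^+ 2 = a * t by rewrite /t mulrC divfK // gt_eqF.
rewrite exprMn -mulrA ler_pM2l ?exprn_gt0 //.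
by rewrite -ler_pdivrMl ?ltr0n ?fact_gt0 // mulrC.
Qed.

Lemma measurable_exprn_normal_pdf n : measurable_fun setT (fun x : R => x ^+ n * pdf x).
Proof. by apply: measurable_funM => //; exact: measurable_normal_pdf. Qed.

Lemma integrable_exprn_normal_pdf n :
  mu.-integrable setT (fun x : R => (x ^+ n * pdf x)%:E).
Proof.
have [C [C0 HC]] := exprn_normal_pdf_le n.
apply: (@le_integrable _ _ _ mu setT measurableT _
    (fun x : R => (C%:E * (normal_pdf 0 (s *+ 2) x)%:E)%E)).
- by apply/measurable_EFinP; exact: measurable_exprn_normal_pdf.
- move=> x _; rewrite /= lee_fin normrM normrX (ger0_norm (normal_pdf_ge0 _ _ _)).
  rewrite [leRHS]ger0_norm ?HC // mulr_ge0 ?normal_pdf_ge0 //.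
- by apply: integrableZl => //; exact: integrable_normal_pdf.
Qed.

Lemma is_derive_normal_pdf (x : R) : is_derive x 1 pdf (- x / s ^+ 2 * pdf x).
Proof.
have -> : pdf = normal_peak s \*: (expR \o (fun x => (- (s ^+ 2 *+ 2)^-1) *: (x ^+ 2))).
  apply/funext => y; rewrite normal_pdfE //= /normal_fun subr0.
  by congr (_ * expR _); rewrite /GRing.scale /= !mulNr mulrC.
apply: is_derive_eq.
by rewrite /= /GRing.scale /=; field.
Qed.

Lemma is_derive_exprn_normal_pdf n (x : R) :
  is_derive x 1 (fun x : R => x ^+ n * pdf x)
    (n%:R * (x ^+ n.-1 * pdf x) - (s ^+ 2)^-1 * (x ^+ n.+1 * pdf x)).
Proof.
have dpdf := is_derive_normal_pdf x.
have -> : (fun x : R => x ^+ n * pdf x) = (id ^+ n) * (pdf : R -> R).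
  by apply/funext => y; rewrite /= fctE exprfctE.
apply: is_derive_eq.
rewrite /= /GRing.scale /= exprfctE; case: n => [|n] /=; last first.
  by rewrite !(exprS x); move: (x ^+ n) (n.+1%:R : R) (pdf x) => a b c; field.
by rewrite expr0 expr1; move: (pdf x) => c; field.
Qed.

Lemma exprn_normal_pdf_cvg0 n :
  (fun N : nat => N.+1%:R ^+ n * pdf N.+1%:R) @ \oo --> (0 : R) /\
  (fun N : nat => (- N.+1%:R) ^+ n * pdf (- N.+1%:R)) @ \oo --> (0 : R).
Proof.
(* The bound for one more power gives decay at least like K / |y|. *)
have [C [C0 HC]] := exprn_normal_pdf_le n.+1.
pose K := C * normal_peak (s *+ 2).
have s20 : s *+ 2 != 0 by rewrite mulrn_eq0.
have FK x : 0 < x -> forall y : R, `|y| = x -> `|y ^+ n * pdf y| <= K * x^-1.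
  move=> x0 y yx; rewrite normrM normrX (ger0_norm (normal_pdf_ge0 _ _ _)).
  rewrite -ler_pdivrMr ?invr_gt0 // invrK mulrC mulrA -{1}yx -exprS.
  by apply: le_trans (HC y) _; rewrite ler_wpM2l // normal_pdf_ub.
have K0 : (fun N : nat => K * N.+1%:R^-1) @ \oo --> (0 : R).
  rewrite -[X in _ --> X](mulr0 K); apply: cvgM; first exact: cvg_cst.
  exact: cvg_harmonic.
have sq (F : R^nat) : (forall N, `|F N| <= K * N.+1%:R^-1) -> F @ \oo --> (0 : R).
  move=> HF; apply: norm_cvg0; 
    apply: (@squeeze_cvgr _ _ _ _ (fun=> 0) (fun N => K * N.+1%:R^-1)) => //.
    by apply: nearW => N; rewrite normr_ge0 HF.
  exact: cvg_cst.
split; apply: sq => N; apply: FK; rewrite ?ltr0n // ?normrN ger0_norm //.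
Qed.

Definition normal_moment n : R := Rintegral mu setT (fun x : R => x ^+ n * pdf x).

(** Gaussian integration by parts: the derivative G of x^n pdf has integral 0, as the boundary terms
    over [-N-1, N+1] vanish in the limit. For n = 0 the predecessor is harmless, being multiplied by
    0. *)
Lemma normal_momentS n :
  normal_moment n.+1 = s ^+ 2 * n%:R * normal_moment n.-1.
Proof.
pose F := fun x : R => x ^+ n * pdf x.
pose G := fun x : R => n%:R * (x ^+ n.-1 * pdf x) - (s ^+ 2)^-1 * (x ^+ n.+1 * pdf x).
have dF (x : R) : is_derive x 1 F (G x) by exact: is_derive_exprn_normal_pdf.
have iG : mu.-integrable setT (EFin \o G).
  rewrite (_ : EFin \o G = (fun x => n%:R%:E * (x ^+ n.-1 * pdf x)%:E) \-
     (fun x => ((s ^+ 2)^-1)%:E * (x ^+ n.+1 * pdf x)%:E))%E //.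
  by apply: integrableB => //; apply: integrableZl => //; exact: integrable_exprn_normal_pdf.
have mG : measurable_fun setT G by apply/measurable_EFinP; exact: measurable_int iG.
have cF m : continuous (fun x : R => x ^+ m * pdf x).
  move=> x; apply/differentiable_continuous/derivable1_diffP.
  by have dFm := is_derive_exprn_normal_pdf m x; exact: ex_derive.
have cG : continuous G.
  by move=> x; apply: cvgB; apply: cvgM; (try exact: cvg_cst); exact: cF.
pose I (N : nat) : set R := `[- N.+1%:R, N.+1%:R]%classic.
have FTC N : (\int[mu]_(x in I N) (G x)%:E = (F N.+1%:R)%:E - (F (- N.+1%:R)%R)%:E)%E.
  apply: continuous_FTC2.
  - by rewrite gtrN // ltr0n.
  - exact: continuous_subspaceT.
  - split; first by move=> x _; exact: ex_derive.
    + by apply: cvg_at_right_filter; exact: cF.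
    + by apply: cvg_at_left_filter; exact: cF.
  - by move=> x _; rewrite derive1E; exact: derive_val.
have [F1 F2] := exprn_normal_pdf_cvg0 n.
have lim0 : (fun N : nat => (F N.+1%:R)%:E - (F (- N.+1%:R)%R)%:E)%E @ \oo --> 0%E.
  under eq_fun => N do rewrite -EFinB.
  apply: cvg_EFin; first by apply: nearW.
  by rewrite -(subrr 0) /=; apply: cvgB.
pose f_ (N : nat) : R -> \bar R := (EFin \o G) \_ (I N).
have f_G (x : R) : f_ ^~ x @ \oo --> (G x)%:E.
  apply: cvg_near_cst; near=> N; rewrite /f_ patchT // inE /I /= in_itv /= -ler_norml.
  near: N; have [m xm] : exists m : nat, `|x| <= m%:R.
    by exists (Num.bound `|x|); apply/ltW/archi_boundP.
  exists m => // N /= mN; apply: le_trans xm _.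
  by rewrite ler_nat (leq_trans mN).
have mf_ N : measurable_fun setT (f_ N).
  apply/(measurable_restrictT _ _).1 => //; first exact: measurable_itv.
  by apply: measurable_funTS; apply/measurable_EFinP.
have dc : (fun N => \int[mu]_x f_ N x)%E @ \oo --> (\int[mu]_x (G x)%:E)%E.
  have [] := @dominated_convergence _ _ _ mu setT measurableT
      f_ (EFin \o G) (abse \o (EFin \o G)) => //.
  - exact/measurable_EFinP.
  - by apply: aeW => x _; exact: f_G.
  - exact: integrable_abse.
  - apply: aeW => x N _; rewrite /f_ patchE; case: ifP => // _.
    by rewrite abse0 abse_ge0.
have intG : (\int[mu]_x (G x)%:E = 0)%E.
  apply: (cvg_unique _ _ lim0) => //.
  rewrite (_ : (fun N : nat => _) = (fun N => \int[mu]_x f_ N x)%E) //.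
  by apply/funext => N; rewrite -FTC integral_mkcond.
have i1 : (\int[mu]_x (G x)%:E =
    (n%:R * normal_moment n.-1 - (s ^+ 2)^-1 * normal_moment n.+1)%:E)%E.
  have h m : (\int[mu]_x (x ^+ m * pdf x)%:E = (normal_moment m)%:E)%E.
    rewrite /normal_moment /Rintegral fineK //.
    by apply: integrable_fin_num => //; exact: integrable_exprn_normal_pdf.
  under eq_integral => x _ do rewrite /G EFinB.
  rewrite integralB //; last 2 first.
  - under eq_fun => x do rewrite EFinM.
    by apply: integrableZl => //; exact: integrable_exprn_normal_pdf.
  - under eq_fun => x do rewrite EFinM.
    by apply: integrableZl => //; exact: integrable_exprn_normal_pdf.
  under eq_integral => x _ do rewrite EFinM.
  rewrite integralZl //; last exact: integrable_exprn_normal_pdf.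
  under [X in (_ - X)%E]eq_integral => x _ do rewrite EFinM.
  by rewrite integralZl //; [rewrite !h|exact: integrable_exprn_normal_pdf].
move: i1; rewrite intG => -[] /eqP; rewrite eq_sym subr_eq0 => /eqP i1.
by rewrite -mulrA i1 mulrA divff ?mul1r // sqrf_eq0.
Unshelve. all: by end_near. Qed.

Lemma normal_moment0 : normal_moment 0 = 1.
Proof.
rewrite /normal_moment /Rintegral.
under eq_integral => x _ do rewrite expr0 mul1r.
by rewrite integral_normal_pdf.
Qed.

Section GaussianVariable.
Context d (T : measurableType d) (P : probability T R) (Y : T -> R).
Hypothesis mY : measurable_fun setT Y.
Hypothesis YN : forall A : set R, measurable A -> P (Y @^-1` A) = normal_prob 0 s A.

Lemma integral_gaussian (h : R -> R) : measurable_fun setT h ->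
  (\int[P]_w (h (Y w))%:E = \int[mu]_x (h x * pdf x)%:E)%E.
Proof.
move=> mh.
transitivity (\int[normal_prob 0 s]_x (h x)%:E)%E.
  rewrite -(@integral_density_pushforward _ _ R T _ P (normal_prob 0 s) Y (cst 1)) //.
    by apply: eq_integral => w _; rewrite mul1r.
  move=> A mA; under eq_integral => w _ do rewrite mul1r.
  transitivity (P (Y @^-1` A)); last exact: YN.
  rewrite -[in RHS](setIT (Y @^-1` A)) -integral_indic //.
  by rewrite -[X in measurable X]setTI; exact: mY.
rewrite -(@integral_density_pushforward _ _ R _ _ mu (normal_prob 0 s) id pdf) //.
- by apply: eq_integral => x _; rewrite mulrC.
- exact: measurable_normal_pdf.
- by move=> x; exact: normal_pdf_ge0.
- exact: normal_prob_density.
Qed.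

Lemma integrable_gaussian n : P.-integrable setT (fun w => (`|Y w| ^+ n)%:E).
Proof.
apply/integrableP; split.
  apply/measurable_EFinP; apply: measurable_funX; exact: measurableT_comp.
have := integrable_exprn_normal_pdf n => /integrableP[_].
congr (_ < _)%E.
transitivity (\int[P]_w ((fun x => `|x ^+ n|) (Y w))%:E)%E; last first.
  by apply: eq_integral => w _; rewrite /= normrX normrX normr_id.
rewrite (@integral_gaussian (fun x => `|x ^+ n|)) //; last first.
  by apply: measurableT_comp.
by apply: eq_integral => x _ /=; rewrite normrM (ger0_norm (normal_pdf_ge0 _ _ _)).
Qed.

Lemma Rintegral_gaussian n : Rintegral P setT (fun w => Y w ^+ n) = normal_moment n.
Proof.
by rewrite /Rintegral /normal_moment /Rintegral (@integral_gaussian (fun x => x ^+ n)).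
Qed.
End GaussianVariable.
End GaussianMoments.

Local Open Scope complex_scope.

(** * Random variables with all moments *)

Section Moments.
Context d (T : measurableType d) (R : realType) (P : probability T R).
Implicit Types (u v : T -> R) (Z W : T -> R[i]).

(** Unlike integrability, the existence of all absolute moments is stable under products, so it
    applies to every polynomial in the matrix entries. *)
Definition has_moments u := measurable_fun setT u /\
  forall n, P.-integrable setT (fun w => (`|u w| ^+ n)%:E).

Lemma has_moments_integrable u : has_moments u -> P.-integrable setT (EFin \o u).
Proof.
move=> [mu /(_ 1) iu]; apply: le_integrable iu => //; first exact/measurable_EFinP.
by move=> w _; rewrite /= expr1 normr_id.
Qed.

Lemma has_moments_le u (v : nat -> T -> R) : measurable_fun setT u ->
  (forall n, P.-integrable setT (EFin \o v n)) ->
  (forall n w, `|u w| ^+ n <= v n w) -> has_moments u.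
Proof.
move=> mu iv uv; split => // n; apply: le_integrable (iv n) => //.
  apply/measurable_EFinP; apply: measurable_funX; exact: measurableT_comp.
move=> w _; rewrite /= lee_fin normrX normr_id.
by apply: le_trans (uv n w) (ler_norm _).
Qed.

Lemma has_moments_cst c : has_moments (cst c).
Proof.
split => // n; exact: (finite_measure_integrable_cst P (`|c| ^+ n) measurableT).
Qed.

Lemma has_momentsD u v : has_moments u -> has_moments v ->
  has_moments (fun w => u w + v w).
Proof.
move=> [mu iu] [mv iv].
apply: (@has_moments_le _ (fun n w => 2 ^+ n * (`|u w| ^+ n + `|v w| ^+ n))).
- exact: measurable_funD.
- move=> n; rewrite [X in _.-integrable _ X](_ : _ =
    (fun w => (2 ^+ n)%:E * ((`|u w| ^+ n)%:E + (`|v w| ^+ n)%:E)))%E.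
    by apply: integrableZl => //; exact: integrableD.
  by apply/funext => w /=; rewrite EFinM EFinD.
move=> n w.
have [uv|/ltW uv] := leP `|u w| `|v w|.
  apply: (@le_trans _ _ ((2 * `|v w|) ^+ n)).
    rewrite lerXn2r ?nnegrE ?mulr_ge0 //; apply: le_trans (ler_normD _ _) _; lra.
  by rewrite exprMn ler_pM2l ?exprn_gt0 // lerDr exprn_ge0.
apply: (@le_trans _ _ ((2 * `|u w|) ^+ n)).
  rewrite lerXn2r ?nnegrE ?mulr_ge0 //; apply: le_trans (ler_normD _ _) _; lra.
by rewrite exprMn ler_pM2l ?exprn_gt0 // lerDl exprn_ge0.
Qed.

Lemma has_momentsM u v : has_moments u -> has_moments v ->
  has_moments (fun w => u w * v w).
Proof.
move=> [mu iu] [mv iv].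
apply: (@has_moments_le _ (fun n w => `|u w| ^+ (2 * n) + `|v w| ^+ (2 * n))).
- exact: measurable_funM.
- move=> n; rewrite [X in _.-integrable _ X](_ : _ =
    (fun w => (`|u w| ^+ (2 * n))%:E + (`|v w| ^+ (2 * n))%:E))%E.
    exact: integrableD.
  by apply/funext => w /=; rewrite EFinD.
move=> n w; rewrite normrM exprMn mulnC !exprM.
move: (`|u w| ^+ n) (`|v w| ^+ n) (exprn_ge0 n (normr_ge0 (u w)))
  (exprn_ge0 n (normr_ge0 (v w))) => a b a0 b0.
have := sqr_ge0 (a - b); have := mulr_ge0 a0 b0; rewrite sqrrB !expr2 -mulr_natr; nra.
Qed.

Lemma has_momentsN u : has_moments u -> has_moments (fun w => - u w).
Proof.
move=> hu; rewrite (_ : (fun w => - u w) = (fun w => cst (-1) w * u w)).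
  by apply: has_momentsM => //; exact: has_moments_cst.
by apply/funext => w; rewrite /= mulN1r.
Qed.

Definition cmoments Z := has_moments (fun w => complex.Re (Z w)) /\
                         has_moments (fun w => complex.Im (Z w)).

Lemma cmoments_cst (c : R[i]) : cmoments (fun=> c).
Proof. by split; apply: has_moments_cst. Qed.

Lemma cmomentsD Z W : cmoments Z -> cmoments W -> cmoments (fun w => Z w + W w).
Proof.
move=> [Zr Zi] [Wr Wi]; split.
  under eq_fun do rewrite raddfD /=.
  exact: has_momentsD.
under eq_fun do rewrite raddfD /=.
exact: has_momentsD.
Qed.

Lemma complex_ReM (a b : R[i]) : complex.Re (a * b) =
  complex.Re a * complex.Re b - complex.Im a * complex.Im b.
Proof. by case: a b => [? ?] [? ?]. Qed.

Lemma complex_ImM (a b : R[i]) : complex.Im (a * b) =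
  complex.Re a * complex.Im b + complex.Im a * complex.Re b.
Proof. by case: a b => [? ?] [? ?]. Qed.

Lemma cmomentsM Z W : cmoments Z -> cmoments W -> cmoments (fun w => Z w * W w).
Proof.
move=> [Zr Zi] [Wr Wi]; split.
  under eq_fun do rewrite complex_ReM.
  apply: has_momentsD; first exact: has_momentsM.
  by apply: has_momentsN; apply: has_momentsM.
under eq_fun do rewrite complex_ImM.
by apply: has_momentsD; apply: has_momentsM.
Qed.

Lemma cmoments_conj Z : cmoments Z -> cmoments (fun w => conjc (Z w)).
Proof.
move=> [Zr Zi]; split.
  rewrite (_ : (fun w => _) = (fun w => complex.Re (Z w))) //.
  by apply/funext => w; case: (Z w).
rewrite (_ : (fun w => _) = (fun w => - complex.Im (Z w))); first exact: has_momentsN.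
by apply/funext => w; case: (Z w).
Qed.

Lemma cmoments_sum (I : Type) (r : seq I) (p : pred I) (Z : I -> T -> R[i]) :
  (forall i, cmoments (Z i)) -> cmoments (fun w => \sum_(i <- r | p i) Z i w).
Proof.
move=> hZ; elim: r => [|i r IH].
  by under eq_fun do rewrite big_nil; apply: cmoments_cst.
under eq_fun do rewrite big_cons.
by case: (p i) => //; apply: cmomentsD.
Qed.

Lemma cmoments_prod (I : Type) (r : seq I) (p : pred I) (Z : I -> T -> R[i]) :
  (forall i, cmoments (Z i)) -> cmoments (fun w => \prod_(i <- r | p i) Z i w).
Proof.
move=> hZ; elim: r => [|i r IH].
  by under eq_fun do rewrite big_nil; apply: cmoments_cst.
under eq_fun do rewrite big_cons.
by case: (p i) => //; apply: cmomentsM.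
Qed.

Lemma cmomentsX Z n : cmoments Z -> cmoments (fun w => Z w ^+ n).
Proof.
move=> hZ; elim: n => [|n IH]; first by under eq_fun do rewrite expr0; exact: cmoments_cst.
by under eq_fun do rewrite exprS; exact: cmomentsM.
Qed.

Lemma cmoments_cintegrable Z : cmoments Z -> cintegrable P Z.
Proof. by move=> [Zr Zi]; split; apply: has_moments_integrable. Qed.

Lemma cexpectationE Z : cexpectation P Z =
  Rintegral P setT (fun w => complex.Re (Z w)) +i*
  Rintegral P setT (fun w => complex.Im (Z w)).
Proof. by rewrite /cexpectation unlock. Qed.

Lemma cexpectationD Z W : cintegrable P Z -> cintegrable P W ->
  cexpectation P (fun w => Z w + W w) = cexpectation P Z + cexpectation P W.
Proof.
move=> [Zr Zi] [Wr Wi]; rewrite !cexpectationE.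
under eq_Rintegral do rewrite raddfD /=.
rewrite RintegralD //.
under [X in _ +i* X]eq_Rintegral do rewrite raddfD /=.
by rewrite RintegralD.
Qed.

Lemma cexpectationZ (c : R[i]) Z : cintegrable P Z ->
  cexpectation P (fun w => c * Z w) = c * cexpectation P Z.
Proof.
move=> [Zr Zi]; rewrite !cexpectationE.
have int a (u : T -> R) : P.-integrable setT (EFin \o u) ->
    P.-integrable setT (EFin \o (fun w => a * u w)).
  move=> iu; rewrite (_ : _ \o _ = (fun w => a%:E * (u w)%:E))%E //.
  exact: integrableZl.
under eq_Rintegral do rewrite complex_ReM.
rewrite RintegralB //; [|exact: int..].
under [X in _ +i* X]eq_Rintegral do rewrite complex_ImM.
rewrite RintegralD //; [|exact: int..].
rewrite !RintegralZl //.
by case: c.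
Qed.

Lemma cexpectation_cst (c : R[i]) : cexpectation P (fun=> c) = c.
Proof.
rewrite cexpectationE !Rintegral_cst // (_ : fine _ = 1) ?mulr1; first by case: c.
by rewrite -[RHS]/(fine 1%E); congr fine; exact: probability_setT.
Qed.

Lemma cexpectation_sum (I : Type) (r : seq I) (p : pred I) (Z : I -> T -> R[i]) :
  (forall i, cmoments (Z i)) ->
  cexpectation P (fun w => \sum_(i <- r | p i) Z i w) =
  \sum_(i <- r | p i) cexpectation P (Z i).
Proof.
move=> hZ; elim: r => [|i r IH].
  by under eq_fun do rewrite big_nil; rewrite big_nil cexpectation_cst.
under eq_fun do rewrite big_cons; rewrite big_cons.
case: (p i) => //; rewrite cexpectationD ?IH //; apply: cmoments_cintegrable => //.
exact: cmoments_sum.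
Qed.

End Moments.

(** * Independence *)

Section Independence.
Context d d' (T : measurableType d) (S : measurableType d') (R : realType)
  (P : probability T R) (I : finType) (Y : I -> T -> S).
Hypothesis YI : mutually_independent P Y.

(* Induction on the set [J] of the factors that are not yet indicators. *)
Lemma ge0_integral_prod_indep (J : {set I}) (H : I -> S -> R) :
  (forall e, measurable_fun setT (H e)) -> (forall e s, 0 <= H e s) ->
  (forall e, P.-integrable setT (fun w => (H e (Y e w))%:E)) ->
  (forall e, e \notin J -> exists2 A, measurable A & H e = \1_A) ->
  (\int[P]_w (\prod_e H e (Y e w))%:E =
   (\prod_e Rintegral P setT (fun w => H e (Y e w)))%:E)%E.
Proof.
have mY e : measurable_fun setT (Y e) by have [] := YI.
have mYA e A : measurable A -> measurable (Y e @^-1` A).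
  by move=> mA; rewrite -[X in measurable X]setTI; exact: mY.
have intA e A : measurable A -> (\int[P]_w (\1_A (Y e w))%:E = P (Y e @^-1` A))%E.
  move=> mA; rewrite -[in RHS](setIT (Y e @^-1` A)) -integral_indic //.
  exact: mYA.
have RintA e A : measurable A -> (Rintegral P setT (fun w => \1_A (Y e w)))%:E = P (Y e @^-1` A).
  by move=> mA; rewrite /Rintegral intA // fineK // fin_num_measure //; exact: mYA.
move: {2}#|J| (erefl #|J|) => n; elim: n J H => [|n IH] J H Jn mH H0 iH HJ.
  have H1 e : exists2 A, measurable A & H e = \1_A.
    by apply: HJ; move/eqP: Jn; rewrite cards_eq0 => /eqP ->; rewrite inE.
  have [A HA] : exists A : I -> set S, forall e, measurable (A e) /\ H e = \1_(A e).
    have /choice[A HA] : forall e, exists A, measurable A /\ H e = \1_A.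
      by move=> e; have [A mA HA] := H1 e; exists A.
    by exists A.
  rewrite -prodEFin.
  under [RHS]eq_bigr => e _ do rewrite (HA e).2 (RintA _ _ (HA e).1).
  have [_ /(_ [set: I]%SET A (fun e => (HA e).1))] := YI.
  under [X in _ = X -> _]eq_bigl do rewrite inE.
  move=> <-; rewrite -[in RHS](setIT (\bigcap_(_ in _) _)) -integral_indic //; last first.
    apply: fin_bigcap_measurable => [|e _]; first exact: finite_finset.
    exact: mYA (HA e).1.
  apply: eq_integral => w _; congr (_%:E); rewrite indicE.
  under eq_bigr => e _ do rewrite (HA e).2 indicE.
  case: (boolP (w \in _)); rewrite ?inE => wA.
    by apply: big1 => e _; rewrite mem_set //; apply: wA => /=; rewrite inE.
  have [e we] : exists e, ~ A e (Y e w).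
    by apply: contrapT => h; apply/negP: wA; rewrite negbK inE => e _ /=;
       apply: contrapT => he; apply: h; exists e.
  by rewrite (bigD1 e) //= memNset // mul0r.
have [m mJ] : exists m, m \in J by apply/set0Pn; rewrite -card_gt0 Jn.
have Jn' : #|J :\ m| = n by move: Jn; rewrite (cardsD1 m) mJ => -[].
pose G w := \prod_(e | e != m) H e (Y e w).
pose c := \prod_(e | e != m) Rintegral P setT (fun w => H e (Y e w)).
have c0 : 0 <= c by apply: prodr_ge0 => e _; apply: Rintegral_ge0.
pose Ym := MeasurableFun.Pack (MeasurableFun.Class (isMeasurableFun.Build _ _ _ _ _ (mY m))).
(* The induction hypothesis, with the factor m made an indicator, says that the measure of density G
   has image [c] times the law of Y m. The pushforward lemma then replaces the indicator by H m. *)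
have GA A : measurable A ->
    (\int[P]_w (G w * \1_A (Y m w))%:E = c%:E * P (Y m @^-1` A))%E.
  move=> mA; pose H' e := if e == m then \1_A else H e.
  have -> : (c%:E * P (Y m @^-1` A) =
      (\prod_e Rintegral P setT (fun w => H' e (Y e w)))%:E)%E.
    rewrite (bigD1 m) //= mulrC EFinM; congr (_ * _)%E.
      by congr EFin; apply: eq_bigr => e em; rewrite /H' (negPf em).
    by rewrite /H' eqxx RintA.
  rewrite -(IH _ H' Jn').
  - apply: eq_integral => w _; rewrite [in RHS](bigD1 m) //= mulrC {1}/H' eqxx.
    congr (_ * _)%:E; apply: eq_bigr => e em; by rewrite /H' (negPf em).
  - by move=> e; rewrite /H'; case: ifP => // _; exact: measurable_indic.
  - by move=> e s; rewrite /H'; case: ifP.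
  - move=> e; rewrite /H'; case: ifP => // _.
    rewrite (_ : (fun w => _) = EFin \o \1_(Y e @^-1` A)) //.
    by apply: integrable_indic => //; exact: mYA.
  - move=> e; rewrite /H'; case: ifP => [_ _|em]; first by exists A.
    by rewrite !inE em /= => eJ; apply: HJ.
rewrite (bigD1 m) //= -/c mulrC.
transitivity (\int[mscale (NngNum c0) (distribution P Ym)]_s (H m s)%:E)%E.
  rewrite -(@ge0_integral_density_pushforward _ _ _ _ _ P
     (mscale (NngNum c0) (distribution P Ym)) (Y m) G) //.
  - by apply: eq_integral => w _; rewrite (bigD1 m) //= mulrC.
  - rewrite (_ : G = fun w => \prod_e (if e != m then H e (Y e w) else 1)).
      by apply: measurable_prod => e _; case: (e != m) => //; exact: measurableT_comp.
    by apply/funext => w; rewrite /G big_mkcond.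
  - by move=> w; apply: prodr_ge0.
rewrite ge0_integral_mscale //; last 2 first.
- exact/measurable_EFinP.
- by move=> s _; rewrite lee_fin.
rewrite EFinM; congr (_ * _)%E.
rewrite ge0_integral_distribution //; last 2 first.
- exact/measurable_EFinP.
- by move=> s; rewrite lee_fin.
rewrite /Rintegral fineK //; apply: integrable_fin_num => //; exact: iH.
Qed.

End Independence.

Section SignedParts.
Variable R : realType.
Implicit Types (b : bool * bool) (z : R[i]).

(* A complex number is a combination of the four nonnegative numbers Re^+, Re^-,
   Im^+ and Im^-, so that the product rule for complex factors follows by
   multilinearity from the one for nonnegative factors. *)
Definition signed_part b z : R :=
  let r := if b.1 then complex.Im z else complex.Re z in
  Num.max (if b.2 then - r else r) 0.

Definition signed_coef b : R[i] := (if b.1 then 'i%C else 1) * (if b.2 then -1 else 1).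

Lemma signed_part_ge0 b z : 0 <= signed_part b z.
Proof. by rewrite /signed_part le_max lexx orbT. Qed.

Lemma signed_partE z : z = \sum_b signed_coef b * (signed_part b z)%:C.
Proof.
have max_sub (r : R) : Num.max r 0 - Num.max (- r) 0 = r.
  by rewrite !maxEle; case: leP => ?; case: leP => ?; lra.
rewrite -(pair_bigA _ (fun b1 b2 : bool => signed_coef (b1, b2) * (signed_part (b1, b2) z)%:C)) /=.
rewrite !big_bool /signed_coef /signed_part /=.
case: z => x y /=; apply/eqP; rewrite eq_complex /=.
have := max_sub x; have := max_sub y.
by move=> hx hy; apply/andP; split; apply/eqP; [rewrite -{1}hy|rewrite -{1}hx]; ring.
Qed.
End SignedParts.

Section ComplexIndependence.
Context d d' (T : measurableType d) (S : measurableType d') (R : realType)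
  (P : probability T R) (I : finType) (Y : I -> T -> S).
Hypothesis YI : mutually_independent P Y.

Lemma has_moments_max0 (u : T -> R) : has_moments P u -> has_moments P (fun w => Num.max (u w) 0).
Proof.
move=> [mu iu]; apply: (has_moments_le _ iu); first exact: measurable_maxr.
move=> n w; rewrite lerXn2r ?nnegrE // ger0_norm ?le_max ?lexx ?orbT //.
by rewrite ge_max normr_ge0 ler_norm.
Qed.

Lemma has_moments_signed_part b (Z : T -> R[i]) : cmoments P Z ->
  has_moments P (fun w => signed_part b (Z w)).
Proof.
move=> [Zr Zi]; apply: has_moments_max0.
by case: b => -[] [] //=; apply: has_momentsN.
Qed.

Lemma cmoments_real (u : T -> R) : has_moments P u -> cmoments P (fun w => (u w)%:C).
Proof. by move=> hu; split => //=; exact: has_moments_cst. Qed.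

Lemma cexpectation_real (u : T -> R) :
  cexpectation P (fun w => (u w)%:C) = (Rintegral P setT u)%:C.
Proof. by rewrite cexpectationE /= Rintegral_cst // mul0r. Qed.

Lemma cexpectation_prod_indep (F : I -> S -> R[i]) :
  (forall e, measurable_fun setT (fun s => complex.Re (F e s))) ->
  (forall e, measurable_fun setT (fun s => complex.Im (F e s))) ->
  (forall e, cmoments P (fun w => F e (Y e w))) ->
  cexpectation P (fun w => \prod_e F e (Y e w)) =
  \prod_e cexpectation P (fun w => F e (Y e w)).
Proof.
move=> mRe mIm hF.
have mpart b e : measurable_fun setT (fun s => signed_part b (F e s)).
  rewrite /signed_part; apply: measurable_maxr => //.
  by case: b => -[] [] //=; apply: measurableT_comp.
have hpart b e := has_moments_signed_part b (hF e).
under [X in cexpectation P X]eq_fun => w.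
  rewrite (eq_bigr _ (fun e _ => signed_partE (F e (Y e w)))) bigA_distr_bigA /=.
  over.
rewrite cexpectation_sum; last first.
  move=> f; apply: cmoments_prod => e; apply: cmomentsM; first exact: cmoments_cst.
  exact: cmoments_real.
under [RHS]eq_bigr => e _.
  rewrite (_ : (fun w => _) = (fun w => \sum_b
      signed_coef R b * (signed_part b (F e (Y e w)))%:C)); last first.
    by apply/funext => w; exact: signed_partE.
  rewrite cexpectation_sum; last first.
    move=> b; apply: cmomentsM; first exact: cmoments_cst.
    exact: cmoments_real.
  over.
rewrite bigA_distr_bigA /=; apply: eq_bigr => f _.
under [X in cexpectation P X]eq_fun => w do rewrite big_split /=.
rewrite cexpectationZ; last first.
  apply: cmoments_cintegrable; apply: cmoments_prod => e; exact: cmoments_real.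
under [RHS]eq_bigr => e _.
  rewrite cexpectationZ; last by apply: cmoments_cintegrable; exact: cmoments_real.
  rewrite cexpectation_real; over.
rewrite [RHS]big_split; congr (_ * _).
under [X in cexpectation P X]eq_fun => w do rewrite -(rmorph_prod (real_complex R)) /=.
rewrite cexpectation_real -(rmorph_prod (real_complex R)); congr (_%:C).
rewrite /Rintegral (ge0_integral_prod_indep YI (J := [set: I]%SET) 
  (H := fun e s => signed_part (f e) (F e s))) //.
- by move=> e s; exact: signed_part_ge0.
- by move=> e; exact: has_moments_integrable.
- by move=> e; rewrite inE.
Qed.

End ComplexIndependence.

(** * Moments of independent complex Gaussian variables *)

Section MomentFunctional.
Variables (K : comNzRingType) (s : K) (m : nat -> K).
Hypothesis m0 : m 0 = 1.
Hypothesis mS : forall n, m n.+1 = s * n%:R * m n.-1.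

(** The expectation of p at a variable with moments m, where [f] takes the expectation of the
    coefficients; this lets the construction be iterated for a second variable. *)
Definition moment_functional (A : comNzRingType) (f : A -> K) (p : {poly A}) : K :=
  \sum_(i < size p) f p`_i * m i.

Section Generic.
Variables (A : comNzRingType) (f : {additive A -> K}).
Local Notation L := (moment_functional f).

Lemma moment_functional_wide (p : {poly A}) n : (size p <= n)%N ->
  L p = \sum_(i < n) f p`_i * m i.
Proof.
move=> pn; rewrite /moment_functional (big_ord_widen n (fun i => f p`_i * m i)) //.
rewrite big_mkcond; apply: eq_bigr => i _; case: ltnP => // pi.
by rewrite nth_default // raddf0 mul0r.
Qed.

Lemma moment_functionalB : zmod_morphism L.
Proof.
move=> p q; pose n := maxn (size p) (size q).
have pn : (size p <= n)%N by rewrite leq_maxl.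
have qn : (size q <= n)%N by rewrite leq_maxr.
have pqn : (size (p - q)%R <= n)%N.
  by apply: leq_trans (size_polyD _ _) _; rewrite size_polyN.
rewrite (moment_functional_wide pn) (moment_functional_wide qn) (moment_functional_wide pqn).
by rewrite -sumrB; apply: eq_bigr => i _; rewrite coefB raddfB mulrBl.
Qed.
HB.instance Definition _ := GRing.isZmodMorphism.Build _ _ L moment_functionalB.

Lemma moment_functionalX (p : {poly A}) : L ('X * p) = s * L p^`().
Proof.
have [n pn] : exists n, (size p <= n.+1)%N by exists (size p).
have sX : (size ('X * p)%R <= n.+2)%N.
  by apply: leq_trans (size_polyMleq _ _) _; rewrite size_polyX.
have sd : (size p^`() <= n.+1)%N.
  by apply: leq_trans (size_poly _ _) (leq_trans (leq_pred _) pn).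
rewrite (moment_functional_wide sX) big_ord_recl coefXM /= raddf0 mul0r add0r.
rewrite (moment_functional_wide sd) mulr_sumr.
rewrite big_ord_recl [RHS]big_ord_recr /= coefXM /= mS mulr0 mul0r mulr0 add0r.
rewrite coef_deriv (nth_default _ pn) mul0rn raddf0 mul0r mulr0 addr0.
apply: eq_bigr => i _; rewrite coefXM coef_deriv /= mS raddfMn /bump /= add1n -mulr_natr /=.
ring.
Qed.

End Generic.

(* [L] is the expectation of a polynomial in two independent variables with
   moments [m]; [mS] says that it satisfies Gaussian integration by parts. *)
Let l : {poly K} -> K := moment_functional idfun.
Let L : {poly {poly K}} -> K := moment_functional l.

Lemma moment_functional2X (p : {poly {poly K}}) :
  L ('X%:P * p) = s * L (map_poly (@deriv K) p).
Proof.
have sX : (size ('X%:P * p)%R <= size p)%N.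
  by rewrite mul_polyC; exact: size_scale_leq.
have sd : (size (map_poly (@deriv K) p) <= size p)%N by exact: size_poly.
rewrite /L (moment_functional_wide _ sX) (moment_functional_wide _ sd) mulr_sumr.
apply: eq_bigr => i _; rewrite coefCM coef_map /= mulrA -moment_functionalX //.
Qed.

Lemma moment_functional2Z (c : K) (p : {poly {poly K}}) : L (c%:P%:P * p) = c * L p.
Proof.
have sX : (size (c%:P%:P * p)%R <= size p)%N.
  by rewrite mul_polyC; exact: size_scale_leq.
rewrite /L (moment_functional_wide _ sX) mulr_sumr.
apply: eq_bigr => i _; rewrite coefCM mulrA; congr (_ * _).
have sq : (size (c%:P * p`_i)%R <= size (p`_i)%R)%N.
  by rewrite mul_polyC; exact: size_scale_leq.
rewrite /= /l (moment_functional_wide _ sq) mulr_sumr.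
by apply: eq_bigr => j _; rewrite coefCM mulrA.
Qed.

Definition is_derivation (A : comNzRingType) (D : A -> A) :=
  forall a b, D (a * b) = D a * b + a * D b.

Lemma derivationX (A : comNzRingType) (D : A -> A) a n : is_derivation D ->
  D (a ^+ n.+1) = n.+1%:R * a ^+ n * D a.
Proof.
move=> DM; elim: n => [|n IH]; first by rewrite expr1 expr0 !mul1r.
by rewrite exprS DM IH -natr1 -[in RHS]natr1 exprS; ring.
Qed.

Lemma map_deriv_derivation : is_derivation (map_poly (@deriv K)).
Proof.
move=> p q; apply/polyP => n; rewrite coefD !coefM coef_map /= coefM raddf_sum -big_split.
by apply: eq_bigr => i _; rewrite /= derivM !coef_map.
Qed.

Variable ii : K.
Hypothesis ii2 : ii * ii = -1.

Let c2 (c : K) : {poly {poly K}} := c%:P%:P.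
Let Z : {poly {poly K}} := 'X%:P + c2 ii * 'X.
Let W : {poly {poly K}} := 'X%:P - c2 ii * 'X.
(** The derivation d/dx + e d/dy, with x the inner and y the outer variable. For e = ii it is twice
    a Wirtinger derivative: it kills Z = x + i y and sends W = x - i y to 2. For e = -ii it kills
    W. *)
Let D (e : K) (p : {poly {poly K}}) := map_poly (@deriv K) p + c2 e * p^`().

Let D_derivation e : is_derivation (D e).
Proof. by move=> p q; rewrite /D map_deriv_derivation derivM; ring. Qed.

Let dX c : map_poly (@deriv K) ('X%:P + c2 c * 'X) = 1.
Proof.
apply/polyP => n; rewrite coef_map /= coefD coefCM coefC coefX coef1.
by case: n => [|[|n]]; rewrite /= ?mulr0 ?mulr1 ?addr0 ?add0r ?derivX ?derivC ?linear0.
Qed.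

Let dY c : ('X%:P + c2 c * 'X : {poly {poly K}})^`() = c2 c.
Proof. by rewrite derivD derivC derivM derivX derivC mul0r add0r mulr1 add0r. Qed.

Let WE : W = 'X%:P + c2 (- ii) * 'X.
Proof. by rewrite /W /c2 !polyCN mulNr. Qed.

Let DE c e : D e ('X%:P + c2 c * 'X) = c2 (1 + e * c).
Proof. by rewrite /D dX dY /c2 -!polyCM -!polyC1 -!polyCD. Qed.

Let LD p q : L (p + q) = L p + L q.
Proof. exact: (raddfD (moment_functional (moment_functional idfun))). Qed.

Let L0 : L 0 = 0.
Proof. exact: (raddf0 (moment_functional (moment_functional idfun))). Qed.

Let LX c p : L (('X%:P + c2 c * 'X) * p) = s * L (D c p).
Proof.
rewrite mulrDl -mulrA LD moment_functional2X moment_functional2Z.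
by rewrite {2}/L moment_functionalX -/L /D LD moment_functional2Z; ring.
Qed.

(** Integrating one factor Z by parts gives s times the expectation of D ii of the rest, and this
    derivation only sees W: the moment (a + 1, b + 1) is 2 s (b + 1) times the moment (a, b). *)
Lemma moment_functional_ZW a b :
  L (Z ^+ a * W ^+ b) = (a == b)%:R * a`!%:R * (2 * s) ^+ a.
Proof.
have L1 : L 1 = 1.
  rewrite /L /moment_functional size_poly1 big_ord1 coef1 /= m0 mulr1.
  by rewrite /l /moment_functional size_poly1 big_ord1 coef1 /= m0 mulr1.
have D0 e : D e 1 = 0.
  have d1 (A : comNzRingType) : (1 : {poly A})^`() = 0 by rewrite -(polyC1 A) derivC.
  rewrite /D d1 mulr0 addr0; apply/polyP => n; rewrite coef_map coef1 coef0 /=.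
  by case: n => [|n]; rewrite ?d1 ?linear0.
elim: a b => [|a IH] b.
  rewrite expr0 mul1r; case: b => [|b]; first by rewrite !expr0 L1 fact0 !mulr1.
  rewrite exprS {1}WE LX mul0r mul0r.
  case: b => [|b]; first by rewrite expr0 D0 L0 mulr0.
  rewrite (derivationX _ _ (D_derivation _)) {2}WE DE mulrNN ii2.
  by rewrite /c2 subrr !polyC0 mulr0 L0 mulr0.
rewrite exprS -mulrA LX D_derivation.
have DZ n : D ii (Z ^+ n) = 0.
  case: n => [|n]; first by rewrite expr0 D0.
  by rewrite (derivationX _ _ (D_derivation _)) DE ii2 subrr /c2 !polyC0 mulr0.
rewrite DZ mul0r add0r; case: b => [|b].
  by rewrite expr0 D0 mulr0 L0 mulr0 !mul0r.
rewrite (derivationX _ _ (D_derivation _)) {2}WE DE mulrN ii2 opprK.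
have -> : Z ^+ a * (b.+1%:R * W ^+ b * c2 (1 + 1)) = c2 (b.+1%:R * 2) * (Z ^+ a * W ^+ b).
  have -> : (b.+1%:R : {poly {poly K}}) = c2 b.+1%:R by rewrite /c2 -!polyC_natr.
  by rewrite /c2 !polyCM -[1 + 1]/(2 : K); ring.
rewrite moment_functional2Z IH eqSS; case: eqP => [->|_]; last by rewrite !mul0r !mulr0.
by rewrite factS natrM exprS; ring.
Qed.

End MomentFunctional.

Section CMeasurable.
Context d (S : measurableType d) (R : realType).
Implicit Types F G : S -> R[i].

Definition cmeasurable F := measurable_fun setT (fun s => complex.Re (F s)) /\
                            measurable_fun setT (fun s => complex.Im (F s)).

Lemma cmeasurable_cst (c : R[i]) : cmeasurable (fun=> c).
Proof. by split. Qed.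

Lemma cmeasurableM F G : cmeasurable F -> cmeasurable G ->
  cmeasurable (fun s => F s * G s).
Proof.
move=> [Fr Fi] [Gr Gi]; split.
  under eq_fun do rewrite complex_ReM.
  by apply: measurable_funB; apply: measurable_funM.
under eq_fun do rewrite complex_ImM.
by apply: measurable_funD; apply: measurable_funM.
Qed.

Lemma cmeasurableX F n : cmeasurable F -> cmeasurable (fun s => F s ^+ n).
Proof.
move=> mF; elim: n => [|n IH].
  by under eq_fun do rewrite expr0; apply: cmeasurable_cst.
under eq_fun do rewrite exprS; exact: cmeasurableM.
Qed.

Lemma cmeasurable_conj F : cmeasurable F -> cmeasurable (fun s => conjc (F s)).
Proof.
move=> [Fr Fi]; split.
  rewrite (_ : (fun s => _) = (fun s => complex.Re (F s))) //.
  by apply/funext => w; case: (F w).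
rewrite (_ : (fun s => _) = (fun s => - complex.Im (F s))); first exact: measurableT_comp.
by apply/funext => w; case: (F w).
Qed.
End CMeasurable.

Section ComplexGaussian.
Context d (T : measurableType d) (R : realType) (P : probability T R).
Variable (v : R).
Hypothesis v0 : 0 < v.

Lemma has_moments_gaussian (u : T -> R) : is_gaussian P 0 v u -> has_moments P u.
Proof.
move=> [mu uN]; split => // n.
by apply: (integrable_gaussian _ mu uN); rewrite gt_eqF // sqrtr_gt0.
Qed.

Lemma Rintegral_gaussian_exp (u : T -> R) n : is_gaussian P 0 v u ->
  Rintegral P setT (fun w => u w ^+ n) = normal_moment (Num.sqrt v) n.
Proof.
by move=> [mu uN]; exact: (Rintegral_gaussian mu uN n).
Qed.
End ComplexGaussian.

Section ComplexGaussianMoments.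
Context d (T : measurableType d) (R : realType) (P : probability T R).
Variables (v : R) (Z : T -> R[i]).
Hypotheses (v0 : 0 < v) (ZG : is_complex_gaussian P v Z).

Let v20 : 0 < v / 2. Proof. by rewrite divr_gt0. Qed.

Lemma cmoments_gaussian : cmoments P Z.
Proof.
have [Zr Zi _] := ZG.
by split; apply: has_moments_gaussian; [exact: v20|exact: Zr|exact: v20|exact: Zi].
Qed.

Let m n : R[i] := (normal_moment (Num.sqrt (v / 2)) n)%:C.

Lemma cexpectation_ReX_ImX a b :
  cexpectation P (fun w => (complex.Re (Z w))%:C ^+ a * (complex.Im (Z w))%:C ^+ b) =
  m a * m b.
Proof.
have [Zr Zi Zind] := ZG.
have [Zrm Zim] := cmoments_gaussian.
have hX (u : T -> R) n : has_moments P u -> cmoments P (fun w => (u w)%:C ^+ n).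
  by move=> hu; apply: cmomentsX; exact: cmoments_real.
pose F (c : bool) (x : R) : R[i] := x%:C ^+ (if c then a else b).
have mF c : cmeasurable (F c).
  by apply: cmeasurableX; split => /=; [exact: measurable_id|exact: measurable_cst].
rewrite (_ : (fun w => _) = (fun w => \prod_c F c
    ((fun (c : bool) w => if c then complex.Re (Z w) else complex.Im (Z w)) c w))); last first.
  by apply/funext => w; rewrite big_bool.
rewrite (cexpectation_prod_indep Zind (fun c => (mF c).1) (fun c => (mF c).2)); last first.
  by case; apply: hX.
rewrite big_bool /F /=.
have E (u : T -> R) n : is_gaussian P 0 (v / 2) u -> cexpectation P (fun w => (u w)%:C ^+ n) = m n.
  move=> uG; under [X in cexpectation P X]eq_fun => w do rewrite -(rmorphXn (real_complex R)).
  by rewrite cexpectation_real /m -(Rintegral_gaussian_exp n uG).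
by rewrite !E.
Qed.

Lemma cexpectation_gaussian a b :
  cexpectation P (fun w => Z w ^+ a * conjc (Z w) ^+ b) =
  ((a == b)%:R * a`!%:R * v ^+ a)%:C.
Proof.
have m0 : m 0 = 1 by rewrite /m normal_moment0.
have s0 : Num.sqrt (v / 2) != 0 by rewrite gt_eqF // sqrtr_gt0.
have mS n : m n.+1 = (v / 2)%:C * n%:R * m n.-1.
  rewrite /m normal_momentS // sqr_sqrtr ?ltW // !rmorphM /=.
  by congr (_ * _ * _); exact: (rmorph_nat (real_complex R)).
have ii2 : 'i%C * 'i%C = -1 :> R[i] by rewrite -expr2 sqr_i.
have := moment_functional_ZW m0 mS ii2 a b.
(* [p] is Z^a W^b as a polynomial; its inner variable is to be evaluated at the real part, its outer
   one at the imaginary part. *)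
set p := (X in moment_functional _ _ X) => LE.
have [Zrm Zim] := cmoments_gaussian.
have hp w : Z w ^+ a * conjc (Z w) ^+ b =
    \sum_(i < size p) \sum_(j < size (p`_i)%R)
     p`_i`_j * ((complex.Re (Z w))%:C ^+ j * (complex.Im (Z w))%:C ^+ i).
  transitivity ((p.[((complex.Im (Z w))%:C)%:P]).[(complex.Re (Z w))%:C]).
    rewrite /p !hornerE; congr (_ ^+ _ * _ ^+ _).
      by rewrite [LHS]complexE mulrC.
    by case: (Z w) => x y; apply/eqP; rewrite eq_complex /=; apply/andP; split; apply/eqP; ring.
  rewrite (horner_coef p) horner_sum; apply: eq_bigr => i _.
  rewrite hornerM horner_exp hornerC horner_coef mulr_suml.
  by apply: eq_bigr => j _; rewrite mulrA.
have hm i j : cmoments P (fun w => (complex.Re (Z w))%:C ^+ j * (complex.Im (Z w))%:C ^+ i).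
  by apply: cmomentsM; apply: cmomentsX; exact: cmoments_real.
under [X in cexpectation P X]eq_fun => w do rewrite hp.
rewrite cexpectation_sum; last first.
  move=> i; apply: cmoments_sum => j; apply: cmomentsM => //; exact: cmoments_cst.
rewrite !rmorphM rmorphXn /= !(rmorph_nat (real_complex R)).
have -> : v%:C = 2 * (v / 2)%:C.
  rewrite -(rmorph_nat (real_complex R)) -rmorphM /=; congr (_%:C); lra.
rewrite -LE; apply: eq_bigr => i _.
rewrite cexpectation_sum; last first.
  by move=> j; apply: cmomentsM => //; exact: cmoments_cst.
rewrite /moment_functional mulr_suml; apply: eq_bigr => j _.
rewrite cexpectationZ; last exact: cmoments_cintegrable.
by rewrite cexpectation_ReX_ImX mulrA.
Qed.
End ComplexGaussianMoments.

(** * Polynomials in independent complex Gaussian variables and the Wick formula *)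

Section GaussianMonomials.
Context d (T : measurableType d) (R : realType) (P : probability T R).
Variables (v : R) (I : finType) (z : T -> I -> R[i]).
Hypotheses (v0 : 0 < v) (zG : forall e, is_complex_gaussian P v (fun w => z w e)).
Hypothesis zI : mutually_independent P (fun e w => re_im (z w e)).

Definition monomial (f g : I -> nat) (w : T) : R[i] :=
  \prod_e (z w e ^+ f e * conjc (z w e) ^+ g e).

Lemma cmoments_monomial f g : cmoments P (monomial f g).
Proof.
apply: cmoments_prod => e; have hz := cmoments_gaussian v0 (zG e).
by apply: cmomentsM; apply: cmomentsX => //; exact: cmoments_conj.
Qed.

Lemma cexpectation_monomial f g : cexpectation P (monomial f g) =
  \prod_e ((f e == g e)%:R * (f e)`!%:R * v%:C ^+ f e).
Proof.
pose F e (s : R * R) : R[i] := (s.1 +i* s.2) ^+ f e * conjc (s.1 +i* s.2) ^+ g e.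
have mF e : cmeasurable (F e).
  have m0 : cmeasurable (fun s : R * R => s.1 +i* s.2).
    by split => /=; [exact: measurable_fst|exact: measurable_snd].
  by apply: cmeasurableM; apply: cmeasurableX => //; exact: cmeasurable_conj.
have FE e w : F e (re_im (z w e)) = z w e ^+ f e * conjc (z w e) ^+ g e.
  by rewrite /F /re_im /=; case: (z w e).
have -> : monomial f g = (fun w => \prod_e F e (re_im (z w e))).
  by apply/funext => w; apply: eq_bigr => e _; rewrite FE.
rewrite (cexpectation_prod_indep zI (fun e => (mF e).1) (fun e => (mF e).2)); last first.
  move=> e; rewrite (_ : (fun w => _) = (fun w => z w e ^+ f e * conjc (z w e) ^+ g e)); last first.
    by apply/funext => w; rewrite FE.
  have hz := cmoments_gaussian v0 (zG e).
  by apply: cmomentsM; apply: cmomentsX => //; exact: cmoments_conj.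
apply: eq_bigr => e _.
rewrite (_ : (fun w => _) = (fun w => z w e ^+ f e * conjc (z w e) ^+ g e)); last first.
  by apply/funext => w; rewrite FE.
rewrite (cexpectation_gaussian v0 (zG e)) !rmorphM rmorphXn /=.
by rewrite !(rmorph_nat (real_complex R)).
Qed.
End GaussianMonomials.

Lemma prod_fibers (K : comPzSemiRingType) (T I : finType) (h : T -> I) (F : I -> K) :
  \prod_a F (h a) = \prod_e F e ^+ #|[pred a | h a == e]|.
Proof.
rewrite (partition_big h xpredT) //=; apply: eq_bigr => e _.
rewrite -prodr_const; apply: eq_big => [a|a /eqP -> //].
by rewrite inE.
Qed.

Section Span.
Context d (T : measurableType d) (R : realType) (P : probability T R).
Variables (v : R) (I : finType) (z : T -> I -> R[i]).
Hypotheses (v0 : 0 < v) (zG : forall e, is_complex_gaussian P v (fun w => z w e)).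
Hypothesis zI : mutually_independent P (fun e w => re_im (z w e)).

Definition supported (A : pred I) (f : I -> nat) := forall e, ~~ A e -> f e = 0%N.

(** The polynomials in the variables indexed by A and their conjugates. For disjoint index sets,
    multiplicativity of the expectation then reduces to the explicit moments of monomials, with no
    appeal to generated sigma-algebras. *)
Definition span_monomials (A : pred I) (Z : T -> R[i]) :=
  exists s : seq (R[i] * ({ffun I -> nat} * {ffun I -> nat})),
    (forall t, t \in s -> supported A t.2.1 /\ supported A t.2.2) /\
    Z = (fun w => \sum_(t <- s) t.1 * monomial z t.2.1 t.2.2 w).

Lemma monomialD f g f' g' w :
  monomial z f g w * monomial z f' g' w =
  monomial z (fun e => f e + f' e)%N (fun e => g e + g' e)%N w.
Proof.
rewrite /monomial -big_split; apply: eq_bigr => e _.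
by rewrite /= !exprD; ring.
Qed.

Lemma cexpectation_monomialM A f g f' g' :
  supported A f -> supported A g -> supported (predC A) f' -> supported (predC A) g' ->
  cexpectation P (fun w => monomial z f g w * monomial z f' g' w) =
  cexpectation P (monomial z f g) * cexpectation P (monomial z f' g').
Proof.
move=> Af Ag Af' Ag'.
under [X in cexpectation P X]eq_fun => w do rewrite monomialD.
rewrite !(cexpectation_monomial v0 zG zI) -big_split; apply: eq_bigr => e _ /=.
have [Ae|Ae] := boolP (A e).
  have -> : f' e = 0%N by apply: Af'; rewrite /= Ae.
  have -> : g' e = 0%N by apply: Ag'; rewrite /= Ae.
  by rewrite !addn0 eqxx fact0 expr0 !mulr1.
have -> : f e = 0%N by exact: Af.
have -> : g e = 0%N by exact: Ag.
by rewrite !add0n eqxx fact0 expr0 !mul1r.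
Qed.

Lemma cmoments_span A Z : span_monomials A Z -> cmoments P Z.
Proof.
move=> [s [_ ->]]; apply: cmoments_sum => t; apply: cmomentsM; first exact: cmoments_cst.
exact: (cmoments_monomial v0 zG).
Qed.

Lemma cexpectation_spanM A Z f g : span_monomials A Z ->
  supported (predC A) f -> supported (predC A) g ->
  cexpectation P (fun w => Z w * monomial z f g w) =
  cexpectation P Z * cexpectation P (monomial z f g).
Proof.
move=> [s [As ->]] Af Ag.
have hm f' g' := cmoments_monomial v0 zG f' g'.
under [X in cexpectation P X]eq_fun => w do rewrite mulr_suml.
rewrite cexpectation_sum; last first.
  move=> t; apply: cmomentsM => //; apply: cmomentsM => //; exact: cmoments_cst.
rewrite cexpectation_sum; last first.
  by move=> t; apply: cmomentsM => //; exact: cmoments_cst.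
rewrite mulr_suml big_seq [RHS]big_seq; apply: eq_bigr => t /As[At1 At2].
under [X in cexpectation P X]eq_fun => w do rewrite -mulrA.
rewrite cexpectationZ; last by apply: cmoments_cintegrable; apply: cmomentsM.
rewrite cexpectationZ; last by apply: cmoments_cintegrable.
by rewrite (cexpectation_monomialM At1 At2 Af Ag) mulrA.
Qed.

Lemma span_cst A c : span_monomials A (fun=> c).
Proof.
exists [:: (c, ([ffun=> 0%N], [ffun=> 0%N]))]; split.
  by move=> t; rewrite inE => /eqP -> /=; split=> e _; rewrite ffunE.
apply/funext => w; rewrite big_seq1 /= /monomial big1 ?mulr1 // => e _.
by rewrite !ffunE !expr0 mulr1.
Qed.

Lemma spanD A Z W : span_monomials A Z -> span_monomials A W ->
  span_monomials A (fun w => Z w + W w).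
Proof.
move=> [s [As ->]] [s' [As' ->]]; exists (s ++ s'); split.
  by move=> t; rewrite mem_cat => /orP[/As|/As'].
by apply/funext => w; rewrite big_cat.
Qed.

Lemma spanM A Z W : span_monomials A Z -> span_monomials A W ->
  span_monomials A (fun w => Z w * W w).
Proof.
move=> [s [As ->]] [s' [As' ->]].
pose tm := (R[i] * ({ffun I -> nat} * {ffun I -> nat}))%type.
pose mulm (t t' : tm) : tm :=
  (t.1 * t'.1, ([ffun e => t.2.1 e + t'.2.1 e]%N, [ffun e => t.2.2 e + t'.2.2 e]%N)).
exists [seq mulm t t' | t <- s, t' <- s'].
split.
  move=> _ /allpairsP[[t t'] /= [/As[t1 t2] /As'[t1' t2'] ->]] /=.
  by split => e Ae; rewrite ffunE ?t1 ?t2 ?t1' ?t2'.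
apply/funext => w; rewrite mulr_suml big_allpairs_dep; apply: eq_bigr => t _.
rewrite mulr_sumr; apply: eq_bigr => t' _ /=.
rewrite mulrACA monomialD; congr (_ * _).
by apply: eq_bigr => e _; rewrite !ffunE.
Qed.

Lemma span_entry (A : pred I) e : A e -> span_monomials A (fun w => z w e).
Proof.
move=> Ae; exists [:: (1, ([ffun e' => nat_of_bool (e' == e)], [ffun=> 0%N]))]; split.
  move=> t; rewrite inE => /eqP -> /=; split=> e' Ae'; rewrite ffunE //.
  by case: eqP Ae' => // ->; rewrite Ae.
apply/funext => w; rewrite big_seq1 /= mul1r /monomial (bigD1 e) //= !ffunE eqxx.
rewrite expr1 expr0 mulr1 big1 ?mulr1 // => e' ee'.
by rewrite !ffunE (negPf ee') !expr0 mulr1.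
Qed.

Lemma span_entry_conj (A : pred I) e : A e -> span_monomials A (fun w => conjc (z w e)).
Proof.
move=> Ae; exists [:: (1, ([ffun=> 0%N], [ffun e' => nat_of_bool (e' == e)]))]; split.
  move=> t; rewrite inE => /eqP -> /=; split=> e' Ae'; rewrite ffunE //.
  by case: eqP Ae' => // ->; rewrite Ae.
apply/funext => w; rewrite big_seq1 /= mul1r /monomial (bigD1 e) //= !ffunE eqxx.
rewrite expr1 expr0 mul1r big1 ?mulr1 // => e' ee'.
by rewrite !ffunE (negPf ee') !expr0 mulr1.
Qed.

Lemma span_sum A (J : Type) (r : seq J) (p : pred J) (Z : J -> T -> R[i]) :
  (forall i, span_monomials A (Z i)) ->
  span_monomials A (fun w => \sum_(i <- r | p i) Z i w).
Proof.
move=> hZ; elim: r => [|i r IH].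
  by under eq_fun do rewrite big_nil; apply: span_cst.
under eq_fun do rewrite big_cons.
by case: (p i) => //; apply: spanD.
Qed.

Lemma span_prod A (J : Type) (r : seq J) (p : pred J) (Z : J -> T -> R[i]) :
  (forall i, span_monomials A (Z i)) ->
  span_monomials A (fun w => \prod_(i <- r | p i) Z i w).
Proof.
move=> hZ; elim: r => [|i r IH].
  by under eq_fun do rewrite big_nil; apply: span_cst.
under eq_fun do rewrite big_cons.
by case: (p i) => //; apply: spanM.
Qed.

(** F and G count the fibers of f and g. Their supports are exported so that the monomial can be
    separated from a polynomial in other variables. *)
Lemma wick_formula k (f g : 'I_k -> I) :
  exists F G : I -> nat,
  [/\ forall A : pred I, (forall a, A (f a)) -> supported A F,
      forall A : pred I, (forall a, A (g a)) -> supported A G,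
      (fun w => \prod_a (z w (f a) * conjc (z w (g a)))) = monomial z F G &
      cexpectation P (monomial z F G) =
      v%:C ^+ k * \sum_(s : 'S_k) \prod_a (f (s a) == g a)%:R].
Proof.
exists (fun e => #|[pred a | f a == e]|), (fun e => #|[pred a | g a == e]|); split.
- by move=> A Af e Ae; apply: eq_card0 => a; rewrite !inE; apply: contraNF Ae => /eqP <-.
- by move=> A Ag e Ae; apply: eq_card0 => a; rewrite !inE; apply: contraNF Ae => /eqP <-.
- apply/funext => w; rewrite big_split /= prod_fibers (prod_fibers g (fun e => conjc (z w e))).
  by rewrite -big_split.
rewrite (cexpectation_monomial v0 zG zI) big_split /= prod_fact_fibers mulrC; congr (_ * _).
by rewrite -(prod_fibers f (fun=> v%:C)) prodr_const card_ord.
Qed.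

End Span.

(** * Exact expectation for a product of Gaussian matrices *)

Local Open Scope sesquilinear_scope.

Section HookEigenvalue.
Variables (K : numFieldType) (k : nat).
Implicit Types (S : {set 'I_k.+1}) (s t : 'S_k.+1).

Definition hook_eigenvalue (x : K) (r : nat) : K := x ^+ k.+1 * hook_factor k x^-1 r.

(** The eigenvalue relation with x^(#cycles) restored, translated by t. *)
Lemma sum_porbits_hook_minor (x : K) S t : x != 0 -> ord0 \notin S ->
  \sum_s hook_minor K S s * x ^+ #|porbits (s * t^-1)%g| =
  hook_eigenvalue x #|S| * hook_minor K S t.
Proof.
move=> x0 S0; rewrite /hook_eigenvalue -mulrA -sum_cycle_weight_hook_minor // mulr_sumr.
rewrite (reindex_inj (mulIg t)) /=; apply: eq_bigr => s _.
rewrite mulgK mulrA mulrC; congr (_ * _); rewrite /cycle_weight card_ord exprVn.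
have le : (#|porbits s| <= k.+1)%N by have := card_porbits_le s; rewrite card_ord.
have -> : x ^+ k.+1 = x ^+ #|porbits s| * x ^+ (k.+1 - #|porbits s|).
  by rewrite -exprD subnKC.
by rewrite mulfK // expf_neq0.
Qed.

End HookEigenvalue.

Section Chain.
Context d (T : measurableType d) (R : realType) (P : probability T R).
Variables (v : R) (p : nat) (N : nat -> nat) (X : T -> forall j, 'M[R[i]]_(N j, N j.+1)).
Hypothesis v0 : 0 < v.
Hypothesis N0 : forall j, (j <= p)%N -> (0 < N j)%N.
Hypothesis XG : forall e : entry_index N p, is_complex_gaussian P v (fun w => entry (X w) e).
Hypothesis XI : mutually_independent P (fun (e : entry_index N p) w => re_im (entry (X w) e)).
Variables (k : nat) (S : {set 'I_k.+1}).
Hypothesis S0 : ord0 \notin S.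

Local Notation C q := (fun w => chain_mulmx (X w) q).
Local Notation z := (fun w (e : entry_index N p) => entry (X w) e).

Definition lower_level (q : nat) : pred (entry_index N p) := fun e => (tag e < q)%N.

Definition level_entry q (qp : (q < p)%N) (a : 'I_(N q)) (b : 'I_(N q.+1)) : entry_index N p :=
  @Tagged _ (Ordinal qp) (fun j : 'I_p => ('I_(N j) * 'I_(N j.+1))%type) (a, b).

Lemma eq_level_entry q (qp : (q < p)%N) a b a' b' :
  (level_entry qp a b == level_entry qp a' b') = (a == a') && (b == b').
Proof. by rewrite eq_Tagged. Qed.

Lemma chain_mulmxS q w a b :
  C q.+1 w a b = \sum_c C q w a c * X w q c b.
Proof. by rewrite /= mxE. Qed.

Lemma span_chain q a b : (q <= p)%N ->
  span_monomials z (lower_level q) (fun w => C q w a b) /\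
  span_monomials z (lower_level q) (fun w => conjc (C q w a b)).
Proof.
elim: q a b => [|q IH] a b qp.
  split.
    exact: (span_cst _ _ (1%:M a b)).
  exact: (span_cst _ _ (conjc (1%:M a b))).
have sub Z : span_monomials z (lower_level q) Z -> span_monomials z (lower_level q.+1) Z.
  move=> [s [As ->]]; exists s; split => // t /As[t1 t2].
  by split => e Ae; [apply: t1|apply: t2]; apply: contra Ae => /leqW.
have lev c : lower_level q.+1 (level_entry qp c b) by rewrite /lower_level /=.
split.
  under [X in span_monomials _ _ X]eq_fun do rewrite chain_mulmxS.
  apply: span_sum => c; apply: spanM; first by apply: sub; apply: (IH _ _ (ltnW qp)).1.
  exact: (span_entry _ (lev c)).
under [X in span_monomials _ _ X]eq_fun do rewrite chain_mulmxS rmorph_sum.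
apply: span_sum => c; under [X in span_monomials _ _ X]eq_fun do rewrite rmorphM.
apply: spanM; first by apply: sub; apply: (IH _ _ (ltnW qp)).2.
exact: (span_entry_conj _ (lev c)).
Qed.

(** The quantity that the induction on the number of factors preserves: the first q matrices, with
    free column labels l and l'. Setting l = l' and summing at q = p gives the hook combination of
    the [perm_trace] of the Gram matrix. *)
Definition chain_sum q (l l' : {ffun 'I_k.+1 -> 'I_(N q)}) (w : T) : R[i] :=
  \sum_(s : 'S_k.+1) hook_minor R[i] S s *
    \sum_(i : {ffun 'I_k.+1 -> 'I_(N 0)})
       \prod_a (C q w (i a) (l a) * conjc (C q w (i (s a)) (l' a))).

Lemma span_chain_sum q (l l' : {ffun 'I_k.+1 -> 'I_(N q)}) : (q <= p)%N ->
  span_monomials z (lower_level q) (chain_sum l l').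
Proof.
move=> qp; apply: span_sum => s; apply: spanM; first exact: span_cst.
apply: span_sum => i; apply: span_prod => a.
by apply: spanM; [apply: (span_chain _ _ qp).1|apply: (span_chain _ _ qp).2].
Qed.

Lemma chain_sumS q (l l' : {ffun 'I_k.+1 -> 'I_(N q.+1)}) w :
  chain_sum l l' w =
  \sum_(m : {ffun 'I_k.+1 -> 'I_(N q)}) \sum_(m' : {ffun 'I_k.+1 -> 'I_(N q)})
    chain_sum m m' w * \prod_a (X w q (m a) (l a) * conjc (X w q (m' a) (l' a))).
Proof.
have expand (s : 'S_k.+1) (i : {ffun 'I_k.+1 -> 'I_(N 0)}) :
    \prod_a (C q.+1 w (i a) (l a) * conjc (C q.+1 w (i (s a)) (l' a))) =
    \sum_(m : {ffun 'I_k.+1 -> 'I_(N q)}) \sum_(m' : {ffun 'I_k.+1 -> 'I_(N q)})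
      \prod_a (C q w (i a) (m a) * conjc (C q w (i (s a)) (m' a))) *
      \prod_a (X w q (m a) (l a) * conjc (X w q (m' a) (l' a))).
  rewrite big_split /=.
  under eq_bigr => a _ do rewrite mxE.
  rewrite bigA_distr_bigA /=.
  under [X in _ * X]eq_bigr => a _ do rewrite mxE rmorph_sum.
  rewrite bigA_distr_bigA /= mulr_suml; apply: eq_bigr => m _.
  rewrite mulr_sumr; apply: eq_bigr => m' _.
  rewrite -!big_split /=; apply: eq_bigr => a _; rewrite rmorphM /=; ring.
rewrite /chain_sum.
under eq_bigr => s _ do under eq_bigr => i _ do rewrite expand.
under eq_bigr => s _ do rewrite exchange_big /= mulr_sumr.
rewrite exchange_big /=; apply: eq_bigr => m _.
under eq_bigr => s _ do rewrite exchange_big /= mulr_sumr.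
rewrite exchange_big /=; apply: eq_bigr => m' _.
rewrite mulr_suml; apply: eq_bigr => s _.
by rewrite -mulr_suml mulrA.
Qed.

(** The last matrix is independent of the earlier ones, so the Wick formula introduces a permutation
    t matching both (m, m') and (l, l'). Summing over m and m' convolves [hook_minor] with
    x^(#cycles), x = N q. The eigenvector property returns the same expression in l and l', times a
    scalar. *)
Lemma cexpectation_chain_sum q (l l' : {ffun 'I_k.+1 -> 'I_(N q)}) : (q <= p)%N ->
  cexpectation P (chain_sum l l') =
  \prod_(j < q) (v%:C ^+ k.+1 * hook_eigenvalue k (N j)%:R #|S|) *
  \sum_(s : 'S_k.+1) hook_minor R[i] S s * \prod_a (l (s a) == l' a)%:R.
Proof.
elim: q l l' => [|q IH] l l' qp.
  rewrite big_ord0 mul1r -[RHS](cexpectation_cst P).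
  congr cexpectation; apply/funext => w; apply: eq_bigr => s _; congr (_ * _).
  rewrite (eq_bigr (fun i : {ffun 'I_k.+1 -> 'I_(N 0)} =>
      \prod_a ((i a == l a)%:R * (i (s a) == l' a)%:R))); last first.
    by move=> i _; apply: eq_bigr => a _; rewrite /= !mxE rmorph_nat.
  rewrite (bigD1 l) //= [X in _ + X]big1 ?addr0.
    by apply: eq_bigr => a _; rewrite eqxx mul1r.
  move=> i il; have [a ia] : exists a, i a != l a.
    apply/existsP; move: il; apply: contraNT; rewrite negb_exists => /forallP h.
    by apply/eqP/ffunP => a; have := h a; rewrite negbK => /eqP.
  by rewrite (bigD1 a) //= (negPf ia) mul0r mul0r.
have hX m m' : cexpectation P (fun w => chain_sum m m' w *
    \prod_a (X w q (m a) (l a) * conjc (X w q (m' a) (l' a)))) =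
    cexpectation P (chain_sum m m') * (v%:C ^+ k.+1 *
      \sum_(t : 'S_k.+1) \prod_a ((m (t a) == m' a)%:R * (l (t a) == l' a)%:R)).
  have [F [G [AF AG FG EFG]]] := wick_formula v0 XG XI
    (fun a => level_entry qp (m a) (l a)) (fun a => level_entry qp (m' a) (l' a)).
  transitivity (cexpectation P (chain_sum m m') * cexpectation P (monomial z F G)).
    rewrite -(cexpectation_spanM v0 XG XI (span_chain_sum m m' (ltnW qp))).
    - by rewrite -FG.
    - by apply: AF => a; rewrite /lower_level /= ltnn.
    - by apply: AG => a; rewrite /lower_level /= ltnn.
  congr (_ * _); rewrite EFG; congr (_ * _); apply: eq_bigr => t _.
  by apply: eq_bigr => a _; rewrite eq_level_entry -natrM mulnb.
have cX (m m' : {ffun 'I_k.+1 -> 'I_(N q)}) : cmoments P (fun w => chain_sum m m' w *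
    \prod_a (X w q (m a) (l a) * conjc (X w q (m' a) (l' a)))).
  apply: cmomentsM.
    exact: (cmoments_span v0 XG (span_chain_sum m m' (ltnW qp))).
  apply: cmoments_prod => a; apply: cmomentsM.
    exact: (cmoments_gaussian v0 (XG (level_entry qp (m a) (l a)))).
  apply: cmoments_conj.
  exact: (cmoments_gaussian v0 (XG (level_entry qp (m' a) (l' a)))).
rewrite (_ : chain_sum l l' = fun w => \sum_(m : {ffun 'I_k.+1 -> 'I_(N q)})
    \sum_(m' : {ffun 'I_k.+1 -> 'I_(N q)}) chain_sum m m' w *
    \prod_a (X w q (m a) (l a) * conjc (X w q (m' a) (l' a)))); last first.
  by apply/funext => w; exact: chain_sumS.
rewrite cexpectation_sum; last by move=> m; apply: cmoments_sum.
under eq_bigr => m _ do rewrite cexpectation_sum //.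
rewrite big_ord_recr /= -[RHS]mulrA.
set mu := \prod_(j < q) _; set V := v%:C ^+ k.+1.
pose B (m m' : {ffun 'I_k.+1 -> 'I_(N q)}) (s : 'S_k.+1) : R[i] := \prod_a (m (s a) == m' a)%:R.
pose L (t : 'S_k.+1) : R[i] := \prod_a (l (t a) == l' a)%:R.
have step m m' : cexpectation P (fun w => chain_sum m m' w *
      \prod_a (X w q (m a) (l a) * conjc (X w q (m' a) (l' a)))) =
    mu * (V * \sum_t \sum_s hook_minor R[i] S s * (B m m' s * B m m' t) * L t).
  rewrite hX IH ?(ltnW qp) // -mulrA; congr (mu * _); rewrite mulrCA; congr (V * _).
  rewrite mulr_sumr; apply: eq_bigr => t _; rewrite mulr_suml; apply: eq_bigr => s _.
  by rewrite big_split /= -/(B m m' t) -/(L t) -/(B m m' s); ring.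
(* The sum over m' forces m' to be m composed with both s and t; what is left counts the m invariant
   under s t^-1. *)
have BB s t : \sum_m \sum_m' B m m' s * B m m' t = (N q)%:R ^+ #|porbits (s * t^-1)%g|.
  rewrite -[N q in RHS]card_ord -sum_perm_invariant; apply: eq_bigr => m _.
  transitivity (\sum_(m' : {ffun 'I_k.+1 -> 'I_(N q)})
      \prod_a ((m (s a) == m' a)%:R * (m (t a) == m' a)%:R : R[i])).
    by apply: eq_bigr => m' _; rewrite /B -big_split.
  rewrite -(bigA_distr_bigA (fun a c => (m (s a) == c)%:R * (m (t a) == c)%:R)) /=.
  apply: eq_bigr => a _; rewrite (bigD1 (m (s a))) //= eqxx mul1r big1 ?addr0.
    by rewrite eq_sym.
  by move=> c cm; rewrite eq_sym (negPf cm) mul0r.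
transitivity (mu * (V * \sum_t (\sum_s hook_minor R[i] S s *
    \sum_m \sum_m' B m m' s * B m m' t) * L t)).
  rewrite (eq_bigr _ (fun m _ => eq_bigr _ (fun m' _ => step m m'))).
  under eq_bigr => m _ do rewrite -!mulr_sumr.
  rewrite -!mulr_sumr; congr (mu * (V * _)).
  under eq_bigr => m _ do rewrite exchange_big.
  rewrite exchange_big; apply: eq_bigr => t _ /=.
  under eq_bigr => m _ do rewrite exchange_big.
  rewrite exchange_big mulr_suml; apply: eq_bigr => s _ /=.
  under eq_bigr => m _ do rewrite -mulr_suml -mulr_sumr.
  by rewrite -mulr_suml -mulr_sumr.
congr (mu * _); rewrite -mulrA; congr (V * _); rewrite mulr_sumr; apply: eq_bigr => t _.
rewrite (eq_bigr (fun s => hook_minor R[i] S s * (N q)%:R ^+ #|porbits (s * t^-1)%g|)); last first.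
  by move=> s _; rewrite BB.
rewrite sum_porbits_hook_minor ?mulrA // pnatr_eq0 -lt0n N0 // ltnW //.
Qed.

(** Closing up with l = l' and summing over l uses the eigenvalue relation once more, at t = 1,
    where [hook_minor] is 1; this is the factor for j = p. *)
Lemma cexpectation_hook_perm_trace :
  cexpectation P (fun w => \sum_(s : 'S_k.+1) hook_minor R[i] S s *
    perm_trace (chain_mulmx (X w) p *m (chain_mulmx (X w) p)^t* ) s) =
  (v%:C ^+ k.+1) ^+ p * \prod_(j < p.+1) hook_eigenvalue k (N j)%:R #|S|.
Proof.
have E w : \sum_(s : 'S_k.+1) hook_minor R[i] S s *
    perm_trace (chain_mulmx (X w) p *m (chain_mulmx (X w) p)^t* ) s =
   \sum_(l : {ffun 'I_k.+1 -> 'I_(N p)}) chain_sum l l w.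
  rewrite /chain_sum exchange_big /=; apply: eq_bigr => s _.
  rewrite -mulr_sumr; congr (_ * _); rewrite [RHS]exchange_big; apply: eq_bigr => i _.
  under eq_bigr => a _ do rewrite mxE.
  rewrite bigA_distr_bigA /=; apply: eq_bigr => l _; apply: eq_bigr => a _.
  by rewrite !mxE.
under [X in cexpectation P X]eq_fun => w do rewrite E.
rewrite cexpectation_sum; last first.
  by move=> l; apply: (cmoments_span v0 XG (span_chain_sum l l (leqnn p))).
under eq_bigr => l _ do rewrite cexpectation_chain_sum //.
rewrite -mulr_sumr big_split /= prodr_const card_ord big_ord_recr /= -!mulrA.
congr (_ * (_ * _)); rewrite exchange_big /=.
have Np0 : (N p)%:R != 0 :> R[i] by rewrite pnatr_eq0 -lt0n N0.
have := sum_porbits_hook_minor 1%g Np0 S0; rewrite hook_minor1 // mulr1 => <-.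
apply: eq_bigr => s _; rewrite -mulr_sumr; congr (_ * _).
rewrite -[N p in RHS]card_ord -sum_perm_invariant; apply: eq_bigr => l _.
by apply: eq_bigr => a _; rewrite perm1.
Qed.

End Chain.

(** * The limit *)

Lemma coef_prod_bound (K : comNzRingType) (I : finType) (q : I -> {poly K}) (D : I -> nat) :
  (forall i, (size (q i) <= (D i).+1)%N) ->
  (size (\prod_i q i)%R <= (\sum_i D i).+1)%N /\
  (\prod_i q i)`_(\sum_i D i) = \prod_i (q i)`_(D i).
Proof.
move=> sq; elim: (index_enum I) => [|i r [IH1 IH2]].
  by rewrite !big_nil coef1 size_poly1.
rewrite !big_cons.
have top (a b : {poly K}) m n : (size a <= m.+1)%N -> (size b <= n.+1)%N ->
    (a * b)`_(m + n) = a`_m * b`_n.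
  move=> sa sb; have lm : (m < (m + n).+1)%N by rewrite ltnS leq_addr.
  rewrite coefM (bigD1 (Ordinal lm)) //= addKn big1 ?addr0 // => j jm.
  have [jm'|jm'] := ltnP j m.
    by rewrite [b`_ _]nth_default ?mulr0 //; apply: leq_trans sb _; lia.
  rewrite [a`_ _]nth_default ?mul0r //; apply: leq_trans sa _.
  rewrite ltn_neqAle jm' andbT eq_sym; apply: contra jm => /eqP jm.
  by apply/eqP/val_inj.
split; last by rewrite top // IH2.
apply: leq_trans (size_polyMleq _ _) _; have := sq i; lia.
Qed.

Section Limit.
Variables (R : realType) (p k : nat).
Local Notation K := k.+1.
Local Notation M := (p * K).+2.

Definition exact_trace (N : nat -> nat) (v : R) : R :=
  (N 0)%:R^-1 * K`!%:R^-1 * (v ^+ K) ^+ p *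
  \sum_(r < K) (-1) ^+ r * 'C(k, r)%:R *
    \prod_(j < p.+1) \prod_(i < K) ((N j)%:R + i%:R - r%:R).

Let c l : {poly R} := (shifted_rising R K)`_l.
Implicit Types l : {ffun 'I_p.+1 -> 'I_M}.

(** The coefficient of the monomial with exponents l in the sizes; it does not depend on N, so only
    [E l] has to pass to the limit. *)
Let coef l : R := K`!%:R^-1 *
  \sum_(r < K) (-1) ^+ r * 'C(k, r)%:R * \prod_j (c (l j)).[r%:R].

Let E l (N : nat -> nat) (v : R) : R :=
  (N 0)%:R^-1 * (v ^+ K) ^+ p * \prod_(j < p.+1) (N j)%:R ^+ l j.

(* For p = 0 the powers up to K of N 0 would not fit in the range ['I_M]. *)
Lemma exact_trace_expand N v : (0 < p)%N ->
  exact_trace N v = \sum_l coef l * E l N v.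
Proof.
move=> p0; rewrite /exact_trace.
have KM : (K.+1 <= M)%N by rewrite ltnS leqW // leq_pmull.
have expand (r : 'I_K) : \prod_(j < p.+1) \prod_(i < K) ((N j)%:R + i%:R - r%:R) =
    \sum_(l : {ffun 'I_p.+1 -> 'I_M})
      (\prod_j (c (l j)).[r%:R]) * \prod_(j < p.+1) (N j)%:R ^+ l j :> R.
  under eq_bigr => j _.
    rewrite -horner_shifted_rising.
    rewrite (horner_coef_wide _ (leq_trans (size_shifted_rising R K) KM)) horner_sum.
    over.
  rewrite bigA_distr_bigA /=; apply: eq_bigr => l _; rewrite -big_split /=.
  by apply: eq_bigr => j _; rewrite hornerM -polyC_exp hornerC.
under eq_bigr => r _ do rewrite expand mulr_sumr.
rewrite exchange_big mulr_sumr /=; apply: eq_bigr => l _.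
under eq_bigr => r _ do rewrite mulrA.
by rewrite -mulr_suml /coef /E; ring.
Qed.

Lemma coef_big l j : (K < l j)%N -> coef l = 0.
Proof.
move=> lj; rewrite /coef big1 ?mulr0 // => r _.
rewrite (bigD1 j) //= /c nth_default ?horner0 ?mul0r ?mulr0 //.
exact: leq_trans (size_shifted_rising R K) lj.
Qed.

Lemma coef_ord0 l : l ord0 = 0%N :> nat -> coef l = 0.
Proof.
move=> l0; rewrite /coef big1 ?mulr0 // => r _.
rewrite (bigD1 ord0) //= l0 [(c 0).[_]](_ : _ = 0) ?mul0r ?mulr0 //.
have -> : c 0 = (shifted_rising R K).[0%:P] by rewrite polyC0 horner_coef0.
rewrite horner_shifted_rising (bigD1 r) //= add0r subrr mul0r //.
Qed.

Let Mle l : ~~ [exists j, (K < l j)%N] -> forall j, (l j <= K)%N.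
Proof. by rewrite negb_exists => /forallP h j; have := h j; rewrite -leqNgt. Qed.

Let sumD l : (forall j, (l j <= K)%N) ->
  (\sum_j (K - l j) + \sum_j l j = p.+1 * K)%N.
Proof.
move=> lK; rewrite -big_split /= -[p.+1 in RHS]card_ord -sum_nat_const.
by apply: eq_bigr => j _; rewrite subnK.
Qed.

(** The product of the c (l j) has degree at most D = sum of the K - l j in the shift, and the
    finite difference extracts its coefficient of degree k. As D plus the sum of the l j is p K + k
    + 1, the case D = k is exactly the Fuss-Narayana degree. The two signs (-1)^k cancel, and K! = K
    k! leaves 1 / K. *)
Let coefE l : (forall j, (l j <= K)%N) -> (\sum_j (K - l j) <= k)%N ->
  coef l = if (\sum_j l j)%N == (p * K).+1 then K%:R^-1 * \prod_j ('C(K, l j))%:R else 0.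
Proof.
move=> lK Dk; have hD := sumD lK.
have [sz top] := coef_prod_bound (fun j => (coef_shifted_rising R (lK j)).1).
rewrite /coef.
rewrite (eq_bigr (fun r : 'I_K => (-1) ^+ r * 'C(k, r)%:R * (\prod_j c (l j)).[r%:R])); last first.
  by move=> r _; rewrite horner_prod.
rewrite finite_difference; last by apply: leq_trans sz _; rewrite ltnS.
case: eqP => hs.
  have Dk' : (\sum_j (K - l j) = k)%N by move: hD; rewrite hs mulSn; lia.
  move: top; rewrite Dk' => ->.
  rewrite (eq_bigr (fun j => (-1) ^+ (K - l j) * ('C(K, l j))%:R)); last first.
    by move=> j _; rewrite (coef_shifted_rising R (lK j)).2 mulr_natr.
  rewrite big_split /= prodrXr Dk' factS natrM.
  have k0 : k`!%:R != 0 :> R by rewrite pnatr_eq0 -lt0n fact_gt0.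
  have ss : (-1) ^+ k * (-1) ^+ k = 1 :> R by rewrite -exprMn mulrNN mul1r expr1n.
  set PC := \prod_i _.
  transitivity ((-1) ^+ k * (-1) ^+ k * ((K%:R * k`!%:R)^-1 * k`!%:R) * PC); first by ring.
  by rewrite ss mul1r invfM divfK.
rewrite nth_default ?mulr0 //; apply: leq_trans sz _.
rewrite ltn_neqAle Dk andbT; apply/eqP => Dk'; apply: hs.
by move: hD; rewrite Dk' mulSn; lia.
Qed.

Lemma exact_trace_cvg (N : nat -> nat -> nat) (x : 'I_p.+1 -> R) : (0 < p)%N ->
  (forall n, (0 < n)%N -> (0 < N n 0)%N) ->
  (forall j : 'I_p.+1, (fun n : nat => (N n j)%:R / n%:R : R) @ \oo --> x j) ->
  (fun n => exact_trace (N n) n%:R^-1) @ \oo --> fuss_narayana K x.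
Proof.
move=> p0 N0 Nx.
under eq_fun => n do rewrite exact_trace_expand //.
rewrite /fuss_narayana big_mkcond /=.
apply: cvg_big => [|l _]; first exact: add_continuous.
have [/existsP[j lj]|/Mle lK] := boolP [exists j, (K < l j)%N].
  rewrite (coef_big lj); under eq_fun => n do rewrite mul0r.
  have -> : \prod_i ('C(K, l i))%:R = 0 :> R by rewrite (bigD1 j) //= bin_small // mul0r.
  rewrite mulr0 mul0r if_same; exact: cvg_cst.
have hD := sumD lK.
(* Here the truncated exponent l 0 - 1 would be wrong, but both sides vanish: p remaining exponents
   at most K cannot sum to p K + 1. *)
have [l0|l0] := posnP (l ord0).
  rewrite (coef_ord0 l0); under eq_fun => n do rewrite mul0r.
  case: eqP => [hs|_]; last exact: cvg_cst.
  have : (\sum_(j < p) l (lift ord0 j) <= p * K)%N.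
    apply: (@leq_trans (\sum_(j < p) K)); first by apply: leq_sum => j _; exact: lK.
    by rewrite sum_nat_const card_ord.
  by move: hs; rewrite big_ord_recl l0 add0n => ->; rewrite ltnn.
have [hs|hs] := leqP (\sum_j l j) (p * K).+1; last first.
  rewrite coefE //; last by move: hD; rewrite mulSn; lia.
  rewrite gtn_eqF //; under eq_fun => n do rewrite mul0r.
  exact: cvg_cst.
(* The sizes occur with total power (sum of the l j) - 1 after division by N 0, against n^(-p K).
   Pairing each size with one 1 / n leaves n^(-e), so only the terms with e = 0 survive. *)
pose e := ((p * K).+1 - \sum_j l j)%N.
pose F := fun n : nat => ((N n 0)%:R / n%:R) ^+ (l ord0).-1 *
  \prod_(j < p) ((N n (lift ord0 j))%:R / n%:R) ^+ l (lift ord0 j) * n%:R^-1 ^+ e : R.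
have EF : \forall n \near \oo, F n = E l (N n) n%:R^-1.
  exists 1 => // n /= n0.
  rewrite /F /E big_ord_recl /=.
  have -> : \prod_(j < p) ((N n (lift ord0 j))%:R / n%:R) ^+ l (lift ord0 j) =
    \prod_(j < p) (N n (lift ord0 j))%:R ^+ l (lift ord0 j) *
       n%:R^-1 ^+ (\sum_(j < p) l (lift ord0 j)) :> R.
    rewrite -prodrXr -big_split; apply: eq_bigr => j _; exact: exprMn.
  have N0n : (N n 0)%:R != 0 :> R by rewrite pnatr_eq0 -lt0n N0.
  rewrite exprMn -exprM.
  have -> : (K * p = (l ord0).-1 + \sum_(j < p) l (lift ord0 j) + e)%N.
    by rewrite /e; move: hs; rewrite big_ord_recl; lia.
  rewrite !exprD -[in RHS](prednK l0) exprS.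
  set P := \prod_(j < p) _.
  by field; rewrite N0n.
have lF : F @ \oo --> (if e == 0%N then x ord0 ^+ (l ord0).-1 *
   \prod_(j < p) x (lift ord0 j) ^+ l (lift ord0 j) else 0).
  have cvgX (u : nat -> R) (a : R) m : u @ \oo --> a -> (fun n => u n ^+ m) @ \oo --> a ^+ m.
    move=> ua; elim: m => [|m IH]; first by under eq_fun do rewrite expr0; exact: cvg_cst.
    under eq_fun do rewrite exprS; rewrite exprS; exact: cvgM.
  have inv0 : (fun n : nat => n%:R^-1 : R) @ \oo --> (0 : R).
    by rewrite -cvg_shiftS; exact: cvg_harmonic.
  have lim1 : (fun n : nat => ((N n 0)%:R / n%:R) ^+ (l ord0).-1 *
      \prod_(j < p) ((N n (lift ord0 j))%:R / n%:R) ^+ l (lift ord0 j)) @ \oo -->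
      x ord0 ^+ (l ord0).-1 * \prod_(j < p) x (lift ord0 j) ^+ l (lift ord0 j).
    apply: cvgM; first exact/cvgX/Nx.
    apply: cvg_big => [|j _]; first exact: mul_continuous.
    exact/cvgX/Nx.
  have lim2 : (fun n : nat => n%:R^-1 ^+ e : R) @ \oo --> ((e == 0%N)%:R : R).
    by rewrite -[(e == 0%N)%:R]expr0n; exact: cvgX.
  rewrite [X in _ --> X](_ : _ = x ord0 ^+ (l ord0).-1 *
      (\prod_(j < p) x (lift ord0 j) ^+ l (lift ord0 j)) * (e == 0%N)%:R).
    exact: cvgM lim1 lim2.
  by case: (e == 0%N); rewrite ?mulr1 ?mulr0.
have lE : (fun n => E l (N n) n%:R^-1) @ \oo --> (if e == 0%N then x ord0 ^+ (l ord0).-1 *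
   \prod_(j < p) x (lift ord0 j) ^+ l (lift ord0 j) else 0).
  exact: cvg_trans (near_eq_cvg EF) lF.
have -> : ((\sum_i l i)%N == (p * K).+1) = (e == 0%N) by rewrite /e; lia.
have -> : (if e == 0%N then K%:R^-1 * (\prod_i ('C(K, l i))%:R) *
     (x ord0 ^+ (l ord0).-1 * \prod_(i < p) x (lift ord0 i) ^+ l (lift ord0 i)) else 0) =
   coef l * (if e == 0%N then x ord0 ^+ (l ord0).-1 *
   \prod_(j < p) x (lift ord0 j) ^+ l (lift ord0 j) else 0).
  case: eqP => e0; last by rewrite mulr0.
  have hs' : (\sum_j l j)%N = (p * K).+1 by move: e0 hs; rewrite /e; lia.
  by rewrite coefE ?hs' ?eqxx //; move: hD; rewrite hs' mulSn; lia.
by apply: cvgM; [exact: cvg_cst|exact: lE].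
Qed.
End Limit.

Section ChainExpectation.
Context d (T : measurableType d) (R : realType) (P : probability T R).
Variables (v : R) (p : nat) (N : nat -> nat) (X : T -> forall j, 'M[R[i]]_(N j, N j.+1)).
Hypothesis v0 : 0 < v.
Hypothesis N0 : forall j, (j <= p)%N -> (0 < N j)%N.
Hypothesis XG : forall e : entry_index N p, is_complex_gaussian P v (fun w => entry (X w) e).
Hypothesis XI : mutually_independent P (fun (e : entry_index N p) w => re_im (entry (X w) e)).

Local Notation BB := (fun w => chain_mulmx (X w) p *m (chain_mulmx (X w) p)^t* ).

Lemma cmoments_gram a b : cmoments P (fun w => BB w a b).
Proof.
rewrite (_ : (fun w => _) = fun w =>
    \sum_c chain_mulmx (X w) p a c * conjc (chain_mulmx (X w) p b c)).
  apply: cmoments_sum => c; apply: cmomentsM.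
    exact: (cmoments_span v0 XG (span_chain X a c (leqnn p)).1).
  exact: (cmoments_span v0 XG (span_chain X b c (leqnn p)).2).
by apply/funext => w; rewrite mxE; apply: eq_bigr => c _; rewrite !mxE.
Qed.

Lemma cmoments_gramX k a b : cmoments P (fun w => (BB w ^+ k) a b).
Proof.
elim: k a b => [|k IH] a b.
  by under eq_fun do rewrite expr0; apply: cmoments_cst.
rewrite (_ : (fun w => _) = fun w => \sum_c BB w a c * (BB w ^+ k) c b).
  by apply: cmoments_sum => c; apply: cmomentsM => //; exact: cmoments_gram.
by apply/funext => w; rewrite exprS mxE.
Qed.

Lemma cmoments_normalized_trace k : cmoments P (fun w => normalized_trace (BB w ^+ k)).
Proof.
apply: cmomentsM; first exact: cmoments_cst.
by apply: cmoments_sum => a; exact: cmoments_gramX.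
Qed.

Lemma expected_trace_gram k :
  expected_trace P (fun w => BB w ^+ k.+1) = (exact_trace p k N v)%:C.
Proof.
pose H (S : {set 'I_k.+1}) w := \sum_(s : 'S_k.+1) hook_minor R[i] S s * perm_trace (BB w) s.
have hH S : cmoments P (H S).
  apply: cmoments_sum => s; apply: cmomentsM; first exact: cmoments_cst.
  apply: cmoments_sum => i; apply: cmoments_prod => a; exact: cmoments_gram.
rewrite /expected_trace.
rewrite (_ : (fun w => _) = fun w => \sum_(S : {set 'I_k.+1} | ord0 \notin S)
    ((N 0)%:R^-1 * k.+1`!%:R^-1 * (-1) ^+ #|S|) * H S w); last first.
  apply/funext => w; rewrite /normalized_trace.
  under eq_bigr => S _ do rewrite -!mulrA.
  rewrite -!mulr_sumr /H perm_trace_mx_exp mulKf //.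
rewrite cexpectation_sum; last by move=> S; apply: cmomentsM => //; exact: cmoments_cst.
pose g r : R[i] := (N 0)%:R^-1 * k.+1`!%:R^-1 * (-1) ^+ r *
   ((v%:C ^+ k.+1) ^+ p * \prod_(j < p.+1) hook_eigenvalue k (N j)%:R r).
rewrite (eq_bigr (fun S : {set 'I_k.+1} => g #|S|)); last first.
  move=> S S0; rewrite cexpectationZ; last exact: cmoments_cintegrable.
  by rewrite /H (cexpectation_hook_perm_trace v0 N0 XG XI S0).
rewrite sum_sets_card /exact_trace -[RHS]/(real_complex R _).
rewrite !rmorphM rmorph_sum /= !fmorphV !rmorph_nat.
rewrite mulr_sumr; apply: eq_bigr => r _.
rewrite !rmorphM !rmorphXn /= rmorphN rmorph1 rmorph_nat rmorph_prod /g -mulr_natr.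
rewrite (eq_bigr (fun j : 'I_p.+1 => real_complex R
   (\prod_(i < k.+1) ((N j)%:R + i%:R - r%:R)))).
  by ring.
move=> j _; rewrite /hook_eigenvalue hook_factor_rising; last by rewrite -ltnS.
  by rewrite rmorph_prod; apply: eq_bigr => i _; rewrite rmorphB rmorphD /= !rmorph_nat.
by rewrite pnatr_eq0 -lt0n N0 // -ltnS.
Qed.
End ChainExpectation.

Lemma cvg_real_complex (R : realType) (f : nat -> R) (l : R) :
  f @ \oo --> l -> (fun n => (f n)%:C : R[i]^o) @ \oo --> (l%:C : R[i]^o).
Proof.
move=> fl; apply/cvgrPdist_lt => e e0.
(* The radius is a complex number here; being positive in the order of R[i] makes it real. *)
have eE : e = (complex.Re e)%:C.
  by move: e0; rewrite ltcE /= => /andP[/eqP ei _]; case: e ei => x y /= ->.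
have re0 : 0 < complex.Re e by move: e0; rewrite ltcE /= => /andP[].
move/cvgrPdist_lt : fl => /(_ _ re0); apply: filterS => n h.
rewrite eE -(rmorphB (real_complex R)) normc_def /= expr0n addr0 sqrtr_sqr.
by rewrite ltcR.
Qed.

Lemma fuss_narayana_p0 (R : realType) k (x : 'I_1 -> R) : fuss_narayana k.+1 x = 1.
Proof.
have lt1 : (1 < (0 * k.+1).+2)%N by [].
rewrite /fuss_narayana (big_pred1 [ffun=> Ordinal lt1]) => [|j]; last first.
  rewrite /= big_ord1; apply/eqP/eqP => [j1|->]; last by rewrite ffunE.
  by apply/ffunP => i; rewrite ffunE ord1; apply: val_inj; rewrite /= j1.
by rewrite big_ord1 big_ord0 ffunE /= bin1 mulVf ?pnatr_eq0 // !mul1r.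
Qed.

Unset Implicit Arguments.
Set Strict Implicit.

Theorem theorem5p1 (R : realType) (p : nat)
  (N : nat -> nat -> nat)
  (Npos : forall n j : nat, (0 < n)%N -> (j <= p)%N -> (0 < N n j)%N)
  (x : 'I_p.+1 -> R)
  (Nlim : forall j : 'I_p.+1,
     (fun n : nat => (N n j)%:R / n%:R : R) @ \oo --> x j)
  (d : nat -> measure_display)
  (T : forall n : nat, measurableType (d n))
  (P : forall n : nat, probability (T n) R)
  (X : forall n : nat, T n -> forall j : nat, 'M[R[i]]_(N n j, N n j.+1))
  (Xgauss : forall (n : nat) (e : entry_index (N n) p), (0 < n)%N ->
     is_complex_gaussian (P n) (n%:R^-1) (fun w => entry (X n w) e))
  (Xindep : forall n : nat, (0 < n)%N ->
     mutually_independent (P n)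
       (fun (e : entry_index (N n) p) w => re_im (entry (X n w) e)))
  (k : nat) (kpos : (0 < k)%N) :
  let B := fun (n : nat) (w : T n) => chain_mulmx (X n w) p in
  (forall n : nat, (0 < n)%N ->
     cintegrable (P n)
       (fun w => normalized_trace ((B n w *m (B n w)^t* ) ^+ k))) /\
  (fun n : nat =>
     expected_trace (P n) (fun w => (B n w *m (B n w)^t* ) ^+ k) : R[i]^o)
    @ \oo --> ((fuss_narayana k x)%:C : R[i]^o).
Proof.
case: k kpos => // k' _ B.
have v0 n : (0 < n)%N -> 0 < (n%:R^-1 : R) by move=> n0; rewrite invr_gt0 ltr0n.
split=> [n n0|].
  by apply: cmoments_cintegrable; apply: (cmoments_normalized_trace (v0 n n0) (Xgauss n ^~ n0)).
have Eexact n : (0 < n)%N ->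
    expected_trace (P n) (fun w => (B n w *m (B n w)^t* ) ^+ k'.+1) =
    (exact_trace p k' (N n) n%:R^-1)%:C.
  move=> n0; apply: (expected_trace_gram (v0 n n0) (Npos n ^~ n0) (Xgauss n ^~ n0) (Xindep n n0)).
have [p0|p0] := posnP p; last first.
  apply: (@cvg_trans _ ((fun n => (exact_trace p k' (N n) n%:R^-1)%:C : R[i]^o) @ \oo)).
    by apply: near_eq_cvg; exists 1%N => // n /= n0; rewrite Eexact.
  by apply: cvg_real_complex; apply: exact_trace_cvg => // n n0; apply: Npos.
(* For p = 0 the product is empty and B is the identity, so the normalized trace is 1. The only
   index in the Fuss-Narayana sum is then j_0 = 1, which also gives 1. *)
apply: (@cvg_trans _ ((fun n => (1 : R)%:C : R[i]^o) @ \oo)).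
  apply: near_eq_cvg; exists 1%N => // n /= n0; rewrite /expected_trace /B.
  move: Npos; rewrite p0 /= trmx1 map_mx1 mulmx1 => Npos0.
  rewrite /normalized_trace expr1n mxtrace1 mulVf ?cexpectation_cst //.
  by rewrite pnatr_eq0 -lt0n Npos0.
apply: cvg_real_complex; move: x Nlim; rewrite p0 => x _.
by rewrite fuss_narayana_p0; exact: cvg_cst.
Qed.
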